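(* Let $A$ be a commutative ring, $n\geq 1$, and let $\phi:\mathcal L^n(A)\to\mathcal L^n(A)$ be a continuous homomorphism of $A$-algebras. Then for any differential form $\omega\in\widetilde\Omega^n_{\mathcal L^n(A)}$, we have $$\mathrm{res}\big(\phi(\omega)\big)=d(\phi)\,\mathrm{res}(\omega),$$ where $d(\phi)=\det(\Upsilon(\phi))$.
   Context: Rings are commutative, associative and unital. For $n\geq 1$, $\mathcal L^n(A)=A((t_1))\ldots((t_n))$ is the ring of iterated Laurent series (inductively $\mathcal L^1(A)=A((t_1))$, $\mathcal L^n(A)=\mathcal L^{n-1}(A)((t_n))$). Elements are written $f=\sum_{l\in\mathbb Z^n}a_lt^l$ with $t^l=t_1^{l_1}\cdots t_n^{l_n}$, and $\mathrm{supp}(f)=\{l: a_l\neq 0\}$. Put $\Lambda_1=\mathbb Z$, $\mathbb Z^1_\lambda=\{l\in\mathbb Z: l\geq\lambda\}$, and for $n\geq 2$ put $\Lambda_n=\mathrm{Map}(\mathbb Z,\Lambda_{n-1})\times\mathbb Z$ and $\mathbb Z^n_\lambda=\bigcup_{l_n\geq\lambda_n}\mathbb Z^{n-1}_{\lambda'(l_n)}\times\{l_n\}$ for $\lambda=(\lambda',\lambda_n)\in\Lambda_n$. A formal series lies in $\mathcal L^n(A)$ iff its support is contained in $\mathbb Z^n_\lambda$ for some $\lambda\in\Lambda_n$. Topology: $\mathcal L^n(A)$ is an additive topological group with a base of open neighborhoods of zero given by the $A$-submodules $U_\lambda=\{f:\mathrm{supp}(f)\cap(-\mathbb Z^n_\lambda)=\varnothing\}$,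 $\lambda\in\Lambda_n$. $\underline{\mathbb Z}(A)$ is the ring of locally constant functions $\mathrm{Spec}(A)\to\mathbb Z$; it maps naturally to $A$ (a function with values $c_i$ on the factors of a finite decomposition $A\simeq\prod_iA_i$ goes to $(c_i\cdot 1)_i$), and elements of $\underline{\mathbb Z}(A)$ act on $A$ through this map. The lexicographical order on $\mathbb Z^n$ compares the last coordinates first: $(l_1,\ldots,l_n)\leq(l_1',\ldots,l_n')$ iff $l_n<l'_n$, or $l_n=l_n'$ and $(l_1,\ldots,l_{n-1})\leq(l'_1,\ldots,l'_{n-1})$. For $f\in\mathcal L^n(A)^*$ it is known that there is a finite decomposition $A\simeq\prod_i A_i$ and elements $l_i\in\mathbb Z^n$ such that the component $\sum_l a_{i,l}t^l\in\mathcal L^n(A_i)$ of $f$ has $a_{i,l}$ nilpotent for all $l<l_i$ and $a_{i,l_i}$ invertible; then $\nu(f)\in\underline{\mathbb Z}(A)^n$ is the locally constant function with value $l_i$ on $\mathrm{Spec}(A_i)$, and $\nu:\mathcal L^n(A)^*\to\underline{\mathbb Z}(A)^n$ is a group homomorphism. Elements of $\underline{\mathbb Z}(A)^n$ are viewed as columns. $\Upsilon(\phi)$ is the $(n\times n)$-matrix over $\underline{\mathbb Z}(A)$ with columns $\nu(\phi(t_1)),\ldots,\nu(\phi(t_n))$; it is known to be upper-triangular with positive diagonal entries (pointwise on $\mathrm{Spec}(A)$), and $d(\phi)\in\underline{\mathbb Z}(A)$ is the product of its diagonal entries, that is, $d(\phi)=\det(\Upsilon(\phi))$. $\widetilde\Omega^1_{\mathcal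 L^n(A)}$ is the quotient of the module of absolute Kähler differentials of $\mathcal L^n(A)$ by the $\mathcal L^n(A)$-submodule generated by all $df-\sum_{i=1}^n\frac{\partial f}{\partial t_i}dt_i$; it is free of rank $n$ with basis $dt_1,\ldots,dt_n$. $\widetilde\Omega^n_{\mathcal L^n(A)}=\bigwedge^n_{\mathcal L^n(A)}\widetilde\Omega^1_{\mathcal L^n(A)}$. The residue map $\mathrm{res}:\widetilde\Omega^n_{\mathcal L^n(A)}\to A$ is the $A$-linear map $\sum_l a_lt^l\,dt_1\wedge\ldots\wedge dt_n\mapsto a_{-1\ldots-1}$. $\phi$ also denotes the induced additive map $\widetilde\Omega^n_{\mathcal L^n(A)}\to\widetilde\Omega^n_{\mathcal L^n(A)}$, $f\,dt_1\wedge\ldots\wedge dt_n\mapsto\phi(f)\,d\phi(t_1)\wedge\ldots\wedge d\phi(t_n)$. *)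

(* Defs.v *)
(* Rings are [comPzRingType], not [comNzRingType]: the zero ring is allowed. *)
From HB Require Import structures.
From mathcomp Require Import all_boot all_order all_algebra ring_quotient.
From mathcomp Require Import boolp classical_sets functions cardinality fsbigop.
From mathcomp Require Import filter topology_structure.
From mathcomp Require Import zify.

Set Implicit Arguments.
Unset Strict Implicit.
Unset Printing Implicit Defensive.

Import Order.TTheory GRing.Theory Num.Theory.

Local Open Scope classical_set_scope.
Local Open Scope ring_scope.
Local Open Scope quotient_scope.

Definition bounded_below (R : comPzRingType) : {pred int -> R} :=
  fun f => `[< exists N : int, forall k : int, k < N -> f k = 0 >].
Arguments bounded_below : clear implicits.

Section BoundedBelow.
Variable R : comPzRingType.
Implicit Types f g : int -> R.

Lemma bounded_belowP f :
  reflect (exists N : int, forall k : int, k < N -> f k = 0) (f \in bounded_below R).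
Proof. exact: asboolP. Qed.

Fact bounded_below_zmod_closed : zmod_closed (bounded_below R).
Proof.
split=> [|f g /bounded_belowP[N fN] /bounded_belowP[M gM]].
  by apply/bounded_belowP; exists 0.
apply/bounded_belowP; exists (Num.min N M) => k; rewrite lt_min => /andP[kN kM].
by rewrite -[LHS]/(f k - g k) fN ?gM ?subr0.
Qed.

HB.instance Definition _ :=
  GRing.isZmodClosed.Build (int -> R) (bounded_below R)
    bounded_below_zmod_closed.

End BoundedBelow.

(* [laurent R] is R((t)); a series is identified with its coefficients. *)
Record laurent (R : comPzRingType) :=
  Laurent { lcoef :> int -> R ; _ : lcoef \in bounded_below R }.

HB.instance Definition _ (R : comPzRingType) := [isSub for @lcoef R].
HB.instance Definition _ (R : comPzRingType) := [Choice of laurent R by <:].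
HB.instance Definition _ (R : comPzRingType) :=
  [SubChoice_isSubZmodule of laurent R by <:].

Section LaurentRing.
Variable R : comPzRingType.
Implicit Types (f g h : laurent R) (u v : int -> R) (k N M : int).

Lemma laurentP f g : (forall k, f k = g k) -> f = g.
Proof. by move=> fg; apply/val_inj/funext. Qed.

Lemma lcoefD f g k : (f + g) k = f k + g k. Proof. by []. Qed.

Lemma laurent_bound f : exists N : int, forall k : int, k < N -> f k = 0.
Proof. exact/bounded_belowP/(valP f). Qed.

(* The sum has only finitely many nonzero terms on Laurent series. *)
Definition lconv u v k : R := \sum_(i \in [set: int]) u i * v (k - i).

Lemma lconvE u v N M (a : int) (m : nat) k :
    (forall i : int, i < N -> u i = 0) -> (forall i : int, i < M -> v i = 0) ->
    a <= N -> k - M < a + m%:Z ->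
  lconv u v k = \sum_(i < m) u (a + i%:Z) * v (k - a - i%:Z).
Proof.
move=> uN vM aN km; rewrite /lconv.
rewrite (fsbigE [seq a + i%:Z | i <- iota 0 m]) //=.
- have -> : iota 0 m = index_iota 0 m by rewrite /index_iota subn0.
  rewrite big_map big_mkord; apply: eq_big => [i|i _]; first by rewrite in_setT.
  by rewrite opprD addrA.
- by rewrite map_inj_uniq ?iota_uniq // => i j /addrI [].
- move=> i _ /negP iNr.
  have [iN|Ni] := ltP i a; first by rewrite uN ?mul0r // (lt_le_trans iN).
  have [im|im] := ltP i (a + m%:Z); last by rewrite vM ?mulr0 //; lia.
  case: iNr; apply/mapP; exists `|i - a|%N; last by lia.
  by rewrite mem_iota; lia.
Qed.

Lemma lconv_bound u v N M :
    (forall i : int, i < N -> u i = 0) -> (forall i : int, i < M -> v i = 0) ->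
  forall k, k < N + M -> lconv u v k = 0.
Proof.
by move=> uN vM k kNM; rewrite (@lconvE _ _ N M N 0) ?big_ord0 //; lia.
Qed.

Fact lmul_subproof f g : lconv f g \in bounded_below R.
Proof.
have [[N fN] [M gM]] := (laurent_bound f, laurent_bound g).
by apply/bounded_belowP; exists (N + M); apply: lconv_bound.
Qed.

Definition lmul f g : laurent R := Laurent (lmul_subproof f g).

Fact lmono_subproof (c : R) (k : int) :
  (fun i : int => if i == k then c else 0) \in bounded_below R.
Proof. by apply/bounded_belowP; exists k => i /lt_eqF ->. Qed.

(* c t^k *)
Definition lmono (c : R) (k : int) : laurent R := Laurent (lmono_subproof c k).

Fact lmulA : associative lmul.
Proof.
move=> f g h; apply: laurentP => k /=.
have [[N fN] [M gM] [P hP]] :=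
  And3 (laurent_bound f) (laurent_bound g) (laurent_bound h).
pose m := (absz (k - N - M - P)%R).+1.
rewrite (@lconvE _ _ N (M + P) N m) //; [|exact: lconv_bound|rewrite /m; lia].
rewrite (@lconvE (lconv f g) _ (N + M) P (N + M) m) //;
  [|exact: lconv_bound|rewrite /m; lia].
have E1 (i : 'I_m) : lconv g h (k - N - i%:Z) =
    \sum_(j < m) g (M - i%:Z + j%:Z) * h (k - N - M - j%:Z).
  rewrite (@lconvE _ _ M P (M - i%:Z) m) //; rewrite ?/m; [|lia..].
  by apply: eq_bigr => j _; congr (_ * h _); lia.
have E2 (j : 'I_m) : lconv f g (N + M + j%:Z) =
    \sum_(i < m) f (N + i%:Z) * g (M - i%:Z + j%:Z).
  rewrite (@lconvE _ _ N M N m) //; last by have := ltn_ord j; lia.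
  by apply: eq_bigr => i _; congr (_ * g _); lia.
under eq_bigr do rewrite E1 mulr_sumr.
under [RHS]eq_bigr do rewrite E2 mulr_suml.
rewrite exchange_big /=; apply: eq_bigr => j _; apply: eq_bigr => i _.
by rewrite mulrA; congr (_ * h _); lia.
Qed.

Fact lmulC : commutative lmul.
Proof.
move=> f g; apply: laurentP => k /=.
have [[N fN] [M gM]] := (laurent_bound f, laurent_bound g).
pose m := (absz (k - N - M)%R).+1.
rewrite (@lconvE _ _ N M N m) //; last by rewrite /m; lia.
rewrite (@lconvE _ _ M N (k - N - m%:Z + 1) m) // ?/m; [|lia..].
rewrite (reindex_inj rev_ord_inj) /=; apply: eq_bigr => i _.
by rewrite mulrC; congr (g _ * f _); have := ltn_ord i; lia.
Qed.

Fact lmul1 : left_id (lmono 1 0) lmul.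
Proof.
move=> f; apply: laurentP => k /=; have [N fN] := laurent_bound f.
pose m := (absz (k - N)%R).+1.
rewrite (@lconvE _ _ 0 N 0 m) //; last by rewrite /m; lia.
  rewrite big_ord_recl /= big1 ?addr0; last by move=> i _; rewrite mul0r.
  by rewrite mul1r; congr (f _); lia.
by move=> i /lt_eqF /= ->.
Qed.

Fact lmulDl : left_distributive lmul +%R.
Proof.
move=> f g h; apply: laurentP => k; rewrite lcoefD /=.
have [[N fN] [M gM] [P hP]] :=
  And3 (laurent_bound f) (laurent_bound g) (laurent_bound h).
have [Q [fQ gQ]] : exists Q : int, (forall i : int, i < Q -> f i = 0) /\
    (forall i : int, i < Q -> g i = 0).
  by exists (Num.min N M); split=> i; rewrite lt_min => /andP[iN iM];
    [apply: fN | apply: gM].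
pose m := (absz (k - Q - P)%R).+1.
have km : k - P < Q + m%:Z by rewrite /m; lia.
have fgQ i : i < Q -> (f + g) i = 0.
  by move=> iQ; rewrite lcoefD fQ // gQ // addr0.
rewrite !(@lconvE _ _ Q P Q m) //.
by rewrite -big_split /=; apply: eq_bigr => i _; rewrite -mulrDl.
Qed.

HB.instance Definition _ := GRing.Zmodule_isComPzRing.Build (laurent R)
  lmulA lmulC lmul1 lmulDl.

Fact lderiv_subproof f :
  (fun k : int => f (k + 1) *~ (k + 1)) \in bounded_below R.
Proof.
have [N fN] := laurent_bound f.
by apply/bounded_belowP; exists (N - 1) => k kN; rewrite fN ?mul0rz //; lia.
Qed.

Definition lderiv f : laurent R := Laurent (lderiv_subproof f).

Fact lderiv_is_zmod_morphism : zmod_morphism lderiv.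
Proof. by move=> f g; apply: laurentP => k; rewrite /= mulrzBl. Qed.

HB.instance Definition _ :=
  GRing.isZmodMorphism.Build (laurent R) (laurent R) lderiv
    lderiv_is_zmod_morphism.

Variable D : {additive R -> R}.

Fact lmap_subproof f : (fun k => D (f k)) \in bounded_below R.
Proof.
have [N fN] := laurent_bound f.
by apply/bounded_belowP; exists N => k kN; rewrite fN ?raddf0.
Qed.

Definition lmap f : laurent R := Laurent (lmap_subproof f).

Fact lmap_is_zmod_morphism : zmod_morphism lmap.
Proof. by move=> f g; apply: laurentP => k; rewrite /= raddfB. Qed.

HB.instance Definition _ :=
  GRing.isZmodMorphism.Build (laurent R) (laurent R) lmap
    lmap_is_zmod_morphism.

End LaurentRing.

(* The recursion starts at L^0(A) = A, so that L^1(A) = A((t_1)). *)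
Fixpoint iter_laurent_ring (A : comPzRingType) (n : nat) : comPzRingType :=
  if n is n'.+1 then laurent (iter_laurent_ring A n') else A.

(* The carrier of L^n(A), named so that it can also bear a topology. *)
Definition iter_laurent (A : comPzRingType) (n : nat) : Type :=
  iter_laurent_ring A n.

HB.instance Definition _ (A : comPzRingType) (n : nat) :=
  GRing.ComPzRing.copy (iter_laurent A n) (iter_laurent_ring A n).

(* Multi-indices are columns; the index i : 'I_n stands for t_(i+1), so that
   the last, outermost, variable has index ord_max, and [row' ord_max] forgets
   its exponent. *)
Fixpoint icoef (A : comPzRingType) (n : nat) :
    iter_laurent A n -> 'cV[int]_n -> A :=
  match n return iter_laurent A n -> 'cV[int]_n -> A with
  | 0 => fun f _ => f
  | n'.+1 => fun f l =>
      @icoef A n' ((f : laurent (iter_laurent_ring A n')) (l ord_max 0))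
        (row' ord_max l)
  end.

(* c t^l *)
Fixpoint monomial (A : comPzRingType) (n : nat) (c : A) :
    'cV[int]_n -> iter_laurent A n :=
  match n return 'cV[int]_n -> iter_laurent A n with
  | 0 => fun _ => c
  | n'.+1 => fun l =>
      lmono (monomial c (row' ord_max l) : iter_laurent_ring A n')
        (l ord_max 0)
  end.

Definition constL (A : comPzRingType) (n : nat) (a : A) : iter_laurent A n :=
  monomial a 0.

Definition tvar (A : comPzRingType) (n : nat) (i : 'I_n) : iter_laurent A n :=
  monomial 1 (delta_mx i 0).

Fixpoint pderiv_rec (A : comPzRingType) (n : nat) :
    'I_n -> {additive iter_laurent_ring A n -> iter_laurent_ring A n} :=
  match n return
    'I_n -> {additive iter_laurent_ring A n -> iter_laurent_ring A n} with
  | 0 => fun _ => idfun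
  | n'.+1 => fun i =>
      if unlift ord_max i is Some j then lmap (@pderiv_rec A n' j)
      else @lderiv (iter_laurent_ring A n')
  end.

Definition pderiv (A : comPzRingType) (n : nat) (i : 'I_n)
  (f : iter_laurent A n) : iter_laurent A n := pderiv_rec A i f.

(* Strict lexicographical order, the last coordinate being compared first. *)
Fixpoint lexlt (n : nat) : 'cV[int]_n -> 'cV[int]_n -> bool :=
  match n return 'cV[int]_n -> 'cV[int]_n -> bool with
  | 0 => fun _ _ => false
  | n'.+1 => fun l l' =>
      (l ord_max 0 < l' ord_max 0) ||
      ((l ord_max 0 == l' ord_max 0) &&
       lexlt (row' ord_max l) (row' ord_max l'))
  end.

(* With Lambda_0 a point, Map(Z, Lambda_0) x Z is Lambda_1 = Z. *)
Fixpoint Lambda (n : nat) : Type :=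
  if n is n'.+1 then ((int -> Lambda n') * int)%type else unit.

Fixpoint Zlambda (n : nat) : Lambda n -> set 'cV[int]_n :=
  match n return Lambda n -> set 'cV[int]_n with
  | 0 => fun _ => setT
  | n'.+1 => fun lam => [set l : 'cV[int]_n'.+1 | lam.2 <= l ord_max 0 /\
      Zlambda (lam.1 (l ord_max 0)) (row' ord_max l)]
  end.

(* Its elements have support disjoint from - Zlambda lam. *)
Definition Ulambda (A : comPzRingType) (n : nat) (lam : Lambda n) :
    set (iter_laurent A n) :=
  [set f | forall l, Zlambda lam (- l) -> icoef f l = 0].

Section Topology.
Variables (A : comPzRingType) (n : nat).
Implicit Types f g : iter_laurent A n.

Fixpoint Lambda_min (m : nat) : Lambda m -> Lambda m -> Lambda m :=
  match m return Lambda m -> Lambda m -> Lambda m with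
  | 0 => fun _ _ => tt
  | m'.+1 => fun lam mu =>
      (fun k => Lambda_min (lam.1 k) (mu.1 k), Num.min lam.2 mu.2)
  end.

Fixpoint Lambda0 (m : nat) : Lambda m :=
  if m is m'.+1 then (fun=> Lambda0 m', 0) else tt.

Lemma Zlambda_min m (lam mu : Lambda m) (l : 'cV_m) :
  Zlambda lam l \/ Zlambda mu l -> Zlambda (Lambda_min lam mu) l.
Proof.
elim: m lam mu l => [//|m IHm] /= lam mu l [][le_l Zl]; split;
  by [rewrite ge_min le_l ?orbT | apply: IHm; auto].
Qed.

Lemma icoefB m (f g : iter_laurent A m) l : icoef (f - g) l = icoef f l - icoef g l.
Proof. by elim: m f g l => [//|m IHm] f g l /=; rewrite -IHm. Qed.

Lemma icoef0 m l : icoef (0 : iter_laurent A m) l = 0.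
Proof. by rewrite -(subrr 0) icoefB subrr. Qed.

Lemma icoefD m (f g : iter_laurent A m) l : icoef (f + g) l = icoef f l + icoef g l.
Proof. by rewrite -[g in LHS]opprK -[- g]sub0r !icoefB icoef0 sub0r opprK. Qed.

Lemma Ulambda0 (lam : Lambda n) : Ulambda lam (0 : iter_laurent A n).
Proof. by move=> l _; rewrite icoef0. Qed.

Lemma UlambdaD (lam : Lambda n) f g :
  Ulambda lam f -> Ulambda lam g -> Ulambda lam (f + g).
Proof. by move=> Uf Ug l Zl; rewrite icoefD Uf // Ug // addr0. Qed.

Lemma Ulambda_min (lam mu : Lambda n) f :
  Ulambda (Lambda_min lam mu) f -> Ulambda lam f /\ Ulambda mu f.
Proof.
by move=> Uf; split=> l Zl; apply: Uf; apply: Zlambda_min; [left|right].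
Qed.

Definition nbhs_laurent f : set_system (iter_laurent A n) :=
  [set S | exists lam : Lambda n, forall g, Ulambda lam (g - f) -> S g].

HB.instance Definition _ := hasNbhs.Build (iter_laurent A n) nbhs_laurent.

Fact nbhs_laurent_filter f : ProperFilter (nbhs f).
Proof.
apply: Build_ProperFilter_ex.
  by move=> S [lam US]; exists f; apply: US; rewrite subrr; apply: Ulambda0.
split; first by exists (Lambda0 n).
  move=> S T [lam US] [mu UT]; exists (Lambda_min lam mu) => g.
  by move=> /Ulambda_min[lamg mug]; split; [apply: US | apply: UT].
by move=> S T ST [lam US]; exists lam => g /US /ST.
Qed.

Fact nbhs_laurent_singleton f (S : set (iter_laurent A n)) : nbhs f S -> S f.
Proof. by move=> [lam]; apply; rewrite subrr; apply: Ulambda0. Qed.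

Fact nbhs_laurent_nbhs f (S : set (iter_laurent A n)) :
  nbhs f S -> nbhs f (nbhs^~ S).
Proof.
move=> [lam US]; exists lam => g Ug; exists lam => h Uh; apply: US.
by rewrite -(subrKA g); apply: UlambdaD.
Qed.

HB.instance Definition _ := Nbhs_isNbhsTopological.Build (iter_laurent A n)
  nbhs_laurent_filter nbhs_laurent_singleton nbhs_laurent_nbhs.

End Topology.

Definition prime_ideal (A : comPzRingType) (p : set A) : Prop :=
  [/\ p 0, forall x y, p x -> p y -> p (x + y), forall a x, p x -> p (a * x),
      ~ p 1 & forall x y, p (x * y) -> p x \/ p y].

Record Spec (A : comPzRingType) :=
  MkSpec { prime_set :> set A ; prime_setP : prime_ideal prime_set }.

HB.instance Definition _ (A : comPzRingType) := gen_eqMixin (Spec A).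
HB.instance Definition _ (A : comPzRingType) := gen_choiceMixin (Spec A).

Section Zariski.
Variable A : comPzRingType.

Definition zariski_open : set_system (Spec A) :=
  [set O | exists E : set A, O = [set p : Spec A | ~ E `<=` p]].

Fact zariski_openT : zariski_open setT.
Proof.
exists setT; apply/esym; rewrite -subTset => p _ /= Tp.
by have [_ _ _ + _] := prime_setP p; apply; apply: Tp.
Qed.

Fact zariski_openI : setI_closed zariski_open.
Proof.
move=> _ _ [E ->] [F ->]; exists [set z | exists x y, [/\ E x, F y & z = x * y]].
apply/seteqP; split=> p /=.
  move=> [/existsNP[x /not_implyP[Ex px]] /existsNP[y /not_implyP[Fy py]]] EFp.
  have [_ _ _ _ /(_ x y) pM] := prime_setP p.
  by case: pM => //; apply: EFp; exists x, y.
have [_ _ pM _ _] := prime_setP p.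
move=> EFp; split=> Sp; apply: EFp => _ [x [y [Ex Fy ->]]].
  by rewrite mulrC; apply/pM/Sp.
exact/pM/Sp.
Qed.

Fact zariski_open_bigU (I : Type) (O : I -> set (Spec A)) :
  (forall i, zariski_open (O i)) -> zariski_open (\bigcup_i O i).
Proof.
move=> /choice[E OE]; exists (\bigcup_i E i); apply/seteqP; split=> p /=.
  by move=> [i _]; rewrite OE /= => + Ep; apply => x Ex; apply: Ep; exists i.
move=> /existsNP[x /not_implyP[[i _ Ex] px]]; exists i => //; rewrite OE /=.
by apply/existsNP; exists x => /(_ Ex).
Qed.

HB.instance Definition _ := isOpenTopological.Build (Spec A)
  zariski_openT zariski_openI zariski_open_bigU.

Definition loc_const : {pred Spec A -> int} :=
  fun c => `[< forall p : Spec A, \forall q \near p, c q = c p >].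

Fact loc_const_subring_closed : subring_closed loc_const.
Proof.
split=> [|c d /asboolP cl /asboolP dl|c d /asboolP cl /asboolP dl];
  apply/asboolP => p; first exact: (@nearW _ (nbhs p)).
- by apply: filterS2 (cl p) (dl p) => q; rewrite -![(c - d) _]/(c _ - d _) => -> ->.
- by apply: filterS2 (cl p) (dl p) => q; rewrite -![(c * d) _]/(c _ * d _) => -> ->.
Qed.

HB.instance Definition _ :=
  GRing.isSubringClosed.Build (Spec A -> int) loc_const loc_const_subring_closed.

End Zariski.
Arguments loc_const : clear implicits.

Record locZ (A : comPzRingType) :=
  LocZ { locZ_fun :> Spec A -> int ; _ : locZ_fun \in loc_const A }.

HB.instance Definition _ (A : comPzRingType) := [isSub for @locZ_fun A].
HB.instance Definition _ (A : comPzRingType) := [Choice of locZ A by <:].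
HB.instance Definition _ (A : comPzRingType) :=
  GRing.SubChoice_isSubComPzRing.Build _ (loc_const A) (locZ A)
    (@loc_const_subring_closed A).

Section SpecMap.
Variables (A B : comPzRingType) (h : {rmorphism A -> B}).

Fact Spec_map_subproof (q : Spec B) : prime_ideal (h @^-1` q).
Proof.
case: q => q [/= q0 qD qM q1 qP]; split=> /=.
- by rewrite rmorph0.
- by move=> x y; rewrite rmorphD; apply: qD.
- by move=> a x; rewrite rmorphM; apply: qM.
- by rewrite rmorph1.
- by move=> x y; rewrite rmorphM; apply: qP.
Qed.

Definition Spec_map (q : Spec B) : Spec A := MkSpec (Spec_map_subproof q).

End SpecMap.

(* A finite decomposition of A as a product of rings, given by the components
   of the isomorphism. *)
Definition decomposition (A : comPzRingType) (m : nat)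
    (B : 'I_m -> comPzRingType) (pr : forall i, {rmorphism A -> B i}) : Prop :=
  bijective (fun (a : A) (i : 'I_m) => pr i a : B i).

(* The value z i is taken on the whole of Spec (B i), seen inside Spec A. *)
Definition has_values (A : comPzRingType) (m : nat)
    (B : 'I_m -> comPzRingType) (pr : forall i, {rmorphism A -> B i})
    (c : locZ A) (z : 'I_m -> int) : Prop :=
  forall i (q : Spec (B i)), c (Spec_map (pr i) q) = z i.

(* The natural map to A: the element c_i . 1 on the i-th factor, for a function
   with values c_i. *)
Definition locZ_to (A : comPzRingType) (c : locZ A) : A :=
  xget 0 [set a : A | exists (m : nat) (B : 'I_m -> comPzRingType)
    (pr : forall i, {rmorphism A -> B i}) (z : 'I_m -> int),
    [/\ decomposition pr, has_values pr c z & forall i, pr i a = (z i)%:~R]].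

Definition nilpotent_elt (R : comPzRingType) (x : R) : Prop :=
  exists k : nat, x ^+ k = 0.

Definition invertible_elt (R : comPzRingType) (x : R) : Prop :=
  exists y, y * x = 1.

Definition is_nu (A : comPzRingType) (n : nat) (f : iter_laurent A n)
    (v : 'cV[locZ A]_n) : Prop :=
  exists (m : nat) (B : 'I_m -> comPzRingType)
    (pr : forall i, {rmorphism A -> B i}) (l : 'I_m -> 'cV[int]_n),
    [/\ decomposition pr,
        forall i l', lexlt l' (l i) -> nilpotent_elt (pr i (icoef f l')),
        forall i, invertible_elt (pr i (icoef f (l i)))
      & forall j, has_values pr (v j 0) (fun i => l i j 0)].

(* Only meaningful when f is invertible: then there is exactly one such v. *)
Definition nu (A : comPzRingType) (n : nat) (f : iter_laurent A n) :
    'cV[locZ A]_n :=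
  xget 0 [set v | is_nu f v].

Definition Upsilon (A : comPzRingType) (n : nat)
    (phi : iter_laurent A n -> iter_laurent A n) : 'M[locZ A]_n :=
  \matrix_(i, j) nu (phi (tvar A j)) i 0.

Definition dphi (A : comPzRingType) (n : nat)
    (phi : iter_laurent A n -> iter_laurent A n) : locZ A :=
  \det (Upsilon phi).

Definition fin_supported (R : comPzRingType) (G : choiceType) :
    {pred G -> R^o} :=
  fun f => `[< finite_set [set x | f x != 0] >].
Arguments fin_supported : clear implicits.

Fact fin_supported_submod_closed (R : comPzRingType) (G : choiceType) :
  submod_closed (fin_supported R G).
Proof.
split=> [|a f g /asboolP ff /asboolP fg]; apply/asboolP.
  by rewrite (_ : mkset _ = set0) // -subset0 => x /=; rewrite eqxx.
apply: (@sub_finite_set _ _ ([set x | f x != 0] `|` [set x | g x != 0])).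
  move=> x /=; apply: contra_neqP => /not_orP[/negP + /negP].
  rewrite !negbK => /eqP fx /eqP gx.
  by rewrite -[LHS]/(a *: f x + g x) fx gx scaler0 addr0.
by rewrite finite_setU.
Qed.

HB.instance Definition _ (R : comPzRingType) (G : choiceType) :=
  GRing.isSubmodClosed.Build R (G -> R^o) (fin_supported R G)
    (@fin_supported_submod_closed R G).

Record free_mod (R : comPzRingType) (G : choiceType) :=
  FreeMod { free_coef : G -> R^o ; _ : free_coef \in fin_supported R G }.

HB.instance Definition _ R G := [isSub for @free_coef R G].
HB.instance Definition _ R G := [Choice of free_mod R G by <:].
HB.instance Definition _ R G := [SubChoice_isSubLmodule of free_mod R G by <:].

Fact free_gen_subproof (R : comPzRingType) (G : choiceType) (g : G) :
  (fun x : G => if x == g then 1 else 0 : R^o) \in fin_supported R G.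
Proof.
apply/asboolP; apply: (@sub_finite_set _ _ [set g]); last exact: finite_set1.
by move=> x /=; case: (x =P g) => //; rewrite eqxx.
Qed.

Definition free_gen (R : comPzRingType) (G : choiceType) (g : G) :
  free_mod R G := FreeMod (free_gen_subproof R g).

Section QuotientModule.
Variables (R : comPzRingType) (M : lmodType R) (S : set M).

Inductive in_span : M -> Prop :=
| in_span0 : in_span 0
| in_span_gen x : S x -> in_span x
| in_span_lin a x y : in_span x -> in_span y -> in_span (a *: x + y).

Definition gen_submod : {pred M} := fun x => `[< in_span x >].

Fact gen_submod_closed : submod_closed gen_submod.
Proof.
split; first exact/asboolP/in_span0.
by move=> a x y /asboolP Sx /asboolP Sy; apply/asboolP/in_span_lin.
Qed.

HB.instance Definition _ := GRing.isSubmodClosed.Build R M gen_submod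
  gen_submod_closed.

Definition quot_mod : Type := Quotient.quot gen_submod.

HB.instance Definition _ := GRing.Zmodule.on quot_mod.

Definition quot_pi (x : M) : quot_mod := \pi_(Quotient.quot gen_submod) x.

Definition quot_scale (a : R) (x : quot_mod) : quot_mod :=
  quot_pi (a *: repr (x : Quotient.quot gen_submod)).

Lemma quot_piP x y : reflect (quot_pi x = quot_pi y) (x - y \in gen_submod).
Proof. by rewrite Quotient.idealrBE; apply: eqP. Qed.

Lemma quot_piD : {morph quot_pi : x y / x + y}.
Proof. exact: Quotient.pi_add. Qed.

Lemma quot_piK (x : quot_mod) : quot_pi (repr (x : Quotient.quot gen_submod)) = x.
Proof. exact: reprK. Qed.

Lemma quot_scaleE a x : quot_scale a (quot_pi x) = quot_pi (a *: x).
Proof. by apply/quot_piP; rewrite -scalerBr rpredZ //; apply/quot_piP/quot_piK. Qed.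

Fact quot_scaleA a b x :
  quot_scale a (quot_scale b x) = quot_scale (a * b) x.
Proof. by rewrite -(quot_piK x) !quot_scaleE scalerA. Qed.

Fact quot_scale1 : left_id 1 quot_scale.
Proof. by move=> x; rewrite -(quot_piK x) quot_scaleE scale1r. Qed.

Fact quot_scaleDr : right_distributive quot_scale +%R.
Proof.
move=> a x y; rewrite -(quot_piK x) -(quot_piK y) -quot_piD !quot_scaleE.
by rewrite scalerDr quot_piD.
Qed.

Fact quot_scaleDl x : {morph quot_scale^~ x : a b / a + b}.
Proof.
by move=> a b; rewrite -(quot_piK x) !quot_scaleE scalerDl quot_piD.
Qed.

HB.instance Definition _ := GRing.Zmodule_isLmodule.Build R quot_mod
  quot_scaleA quot_scale1 quot_scaleDr quot_scaleDl.

End QuotientModule.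

Section Kahler.
Variable R : comPzRingType.

Local Notation gen := (@free_gen R R).

Definition kahler_rel : set (free_mod R R) :=
  [set x | exists f g : R,
     x = gen (f + g) - gen f - gen g \/
     x = gen (f * g) - f *: gen g - g *: gen f].

Definition kahler : lmodType R := quot_mod kahler_rel.

Definition kahler_d (f : R) : kahler := quot_pi kahler_rel (gen f).

End Kahler.

Section ExteriorPower.
Variables (R : comPzRingType) (M : lmodType R) (n : nat).

Local Notation gen := (@free_gen R ('I_n -> M)).

(* The families u, v, w agree away from i in the multilinearity relations. *)
Definition ext_rel : set (free_mod R ('I_n -> M)) :=
  [set x |
    (exists (a : R) (i : 'I_n) (u v w : 'I_n -> M),
      [/\ forall j, j != i -> w j = u j /\ w j = v j, w i = a *: u i + v i
        & x = gen w - a *: gen u - gen v])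
    \/ (exists (i j : 'I_n) (w : 'I_n -> M),
      [/\ i != j, w i = w j & x = gen w])].

Definition ext_power : lmodType R := quot_mod ext_rel.

Definition wedge (w : 'I_n -> M) : ext_power := quot_pi ext_rel (gen w).

End ExteriorPower.

Section Forms.
Variables (A : comPzRingType) (n : nat).
Local Notation L := (iter_laurent A n).

Definition omega1_rel : set (kahler L) :=
  [set x | exists f : L,
     x = kahler_d f - \sum_(i < n) pderiv i f *: kahler_d (tvar A i)].

(* The quotient of [kahler L] written Omega-tilde^1. *)
Definition omega1 : lmodType L := quot_mod omega1_rel.

Definition d1 (f : L) : omega1 := quot_pi omega1_rel (kahler_d f).

Definition omegan : lmodType L := ext_power omega1 n.

Definition dt_wedge : omegan := wedge (fun i => d1 (tvar A i)).

(* The f with w = f dt_1 /\ ... /\ dt_n: there is exactly one, because [omegan]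
   is free of rank one on [dt_wedge]. *)
Definition form_coef (w : omegan) : L := xget 0 [set f : L | w = f *: dt_wedge].

Definition res (w : omegan) : A := icoef (form_coef w) (const_mx (-1)).

Definition form_map (phi : L -> L) (w : omegan) : omegan :=
  phi (form_coef w) *: wedge (fun i => d1 (phi (tvar A i))).

End Forms.

(* Main.v *)
Require Import Defs.
From HB Require Import structures.
From mathcomp Require Import all_boot all_order all_algebra fingroup perm.
From mathcomp Require Import boolp classical_sets functions cardinality fsbigop.
From mathcomp Require Import filter topology_structure.
From mathcomp Require Import finmap zify ring.
From mathcomp.multinomials Require Import monalg.

(* Write g_i for phi(t_i), D_j for t_j d/dt_j, W for the matrix
   (D_j g_i / g_i) and G(l) for phi(t^l). By continuity only the monomials
   omega = t^(l - 1) dt_1 ... dt_n matter, and then res(phi(omega)) is the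
   constant term T_l of G(l) det W: it must vanish for l != 0 and equal d(phi)
   for l = 0.

   The key vanishing: a determinant whose rows are either integer constants or
   of the form x^k (D_1 x, ..., D_n x), at least one row being of the second
   kind, has constant term 0. Indeed x, an arbitrary series, lifts to a ring
   without additive torsion, where k + 1 times the row is the row of
   derivatives of x^(k+1); by multilinearity and continuity one may then replace
   the series to be differentiated by monomials, and the constant term of the
   resulting determinant carries the determinant of linearly dependent
   exponents.

   An invertible series is, on each factor of a finite decomposition of A, of
   the form c t^l (1 + x) with x topologically nilpotent; its row of logarithmic
   derivatives is l plus a limit of sums of rows x^k Dx. This gives T_0 = det(l).
   For l = (k + 1) l' with l' primitive and X = G(l'), the row X^k DX is
   G(l) times the combination of the rows of W with coefficients l', whence
   l'_i T_l = 0 for all i, and T_l = 0. *)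

Set Implicit Arguments.
Unset Strict Implicit.
Unset Printing Implicit Defensive.

Import Order.TTheory GRing.Theory Num.Theory.
Local Open Scope ring_scope.

(** * Coefficients and continuous functionals *)

(** The obstacle is that A may have torsion, nilpotents and idempotents. Torsion forbids dividing
    d(x^(k+1)) by k + 1, and phi does not come with a lift to a torsion-free cover; hence the key
    vanishing is stated for arbitrary series x, which lift coefficient by coefficient with no
    relation to preserve. The primitive l' serves the same end: l itself would give only l_i T_l =
    0, a torsion statement, whereas a Bezout relation among the l'_i gives T_l = 0. The limit of
    sums of rows x^k Dx is never formed: it is replaced by membership in the double annihilator of
    those rows, for which a truncated geometric series is enough. Factors of A are handled inside A,
    by multiplying with idempotents e; actual factor rings appear only to match the definitions of
    nu and of the map from locally constant functions to A. *)

Section OneVariable.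
Variable R : comPzRingType.
Implicit Types (f g : laurent R) (c : R) (i k : int).

Lemma lcoefM_lmono c i f k : (lmono c i * f) k = c * f (k - i).
Proof.
have [N fN] := laurent_bound f.
rewrite -[LHS]/(lconv (lmono c i) f k).
rewrite (@lconvE _ _ _ i N i (absz (k - i - N)%R).+1) //; last by lia.
  rewrite big_ord_recl /= addr0 eqxx subr0 big1 ?addr0 // => j _.
  by rewrite /= /bump ifF ?mul0r //; apply/eqP; lia.
by move=> j /lt_eqF /= ->.
Qed.

Lemma lmonoM c c' i i' : lmono c i * lmono c' i' = lmono (c * c') (i + i').
Proof.
apply: laurentP => k; rewrite lcoefM_lmono /=.
have -> : (k - i == i') = (k == i + i') by apply/eqP/eqP; lia.
by case: ifP; rewrite ?mulr0.
Qed.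

Lemma lmonoD c c' i : lmono (c + c') i = lmono c i + lmono c' i.
Proof. by apply: laurentP => k; rewrite lcoefD /=; case: ifP; rewrite ?addr0. Qed.

Lemma lmonoB c c' i : lmono (c - c') i = lmono c i - lmono c' i.
Proof.
by apply: laurentP => k; rewrite -[RHS]/(_ k - _ k) /=; case: ifP; rewrite ?subr0.
Qed.

Lemma lcoef_sum (I : Type) (r : seq I) (P : pred I) (F : I -> laurent R) k :
  (\sum_(i <- r | P i) F i : laurent R) k = \sum_(i <- r | P i) F i k.
Proof. by elim/big_rec2: _ => // i x y _ <-. Qed.

Lemma lcoefM_fin (f g : laurent R) k N M (m : nat) (a : int) :
    (forall i, i < N -> f i = 0) -> (forall i, i < M -> g i = 0) ->
    a <= N -> k - M < a + m%:Z ->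
  (f * g) k = \sum_(i < m) f (a + i%:Z) * g (k - a - i%:Z).
Proof. exact: lconvE. Qed.

End OneVariable.

Lemma lmono0 (R : comPzRingType) i : lmono (0 : R) i = 0.
Proof. by apply: laurentP => k /=; case: ifP. Qed.

Section Exponents.
Variable n : nat.
Implicit Types (l : 'cV[int]_n) (k : int).

Definition exp_cons k l : 'cV[int]_n.+1 :=
  \col_i (if unlift ord_max i is Some j then l j 0 else k).

Lemma exp_cons_max k l : exp_cons k l ord_max 0 = k.
Proof. by rewrite mxE unlift_none. Qed.

Lemma exp_cons_lift k l j : exp_cons k l (lift ord_max j) 0 = l j 0.
Proof. by rewrite mxE liftK. Qed.

Lemma row'_exp_cons k l : row' ord_max (exp_cons k l) = l.
Proof. by apply/colP => j; rewrite mxE exp_cons_lift. Qed.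

Lemma exp_consK (l : 'cV[int]_n.+1) : exp_cons (l ord_max 0) (row' ord_max l) = l.
Proof. by apply/colP => j; rewrite mxE; case: unliftP => [i|] ->; rewrite ?mxE. Qed.

End Exponents.

Section Coefficients.
Variable A : comPzRingType.

Lemma icoef_ext n (f g : iter_laurent A n) :
  (forall l, icoef f l = icoef g l) -> f = g.
Proof.
elim: n f g => [|n IHn] f g fg; first exact: (fg 0).
apply: laurentP => k; apply: IHn => l.
by have := fg (exp_cons k l); rewrite /= exp_cons_max row'_exp_cons.
Qed.

Lemma icoef_sum n (I : Type) (r : seq I) (P : pred I) (F : I -> iter_laurent A n) l :
  icoef (\sum_(i <- r | P i) F i) l = \sum_(i <- r | P i) icoef (F i) l.
Proof. by apply: (big_morph (fun f => icoef f l)); [move=> f g; apply: icoefD | apply: icoef0]. Qed.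

Lemma icoefN n (f : iter_laurent A n) l : icoef (- f) l = - icoef f l.
Proof. by rewrite -sub0r icoefB icoef0 sub0r. Qed.

Lemma icoefMn n (f : iter_laurent A n) m l : icoef (f *+ m) l = icoef f l *+ m.
Proof. by elim: m => [|m IHm]; rewrite ?icoef0 // !mulrS icoefD IHm. Qed.

Lemma icoefMz n (f : iter_laurent A n) m l : icoef (f *~ m) l = icoef f l *~ m.
Proof. by case: m => m; rewrite /intmul ?icoefN icoefMn. Qed.

Lemma icoef_monoM n c a (f : iter_laurent A n) l :
  icoef (monomial c a * f) l = c * icoef f (l - a).
Proof.
elim: n c a f l => [//|n IHn] c a f l.
rewrite -[LHS]/(icoef ((lmono _ _ * (f : laurent _)) _) _).
by rewrite lcoefM_lmono IHn /= !mxE linearB.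
Qed.

Lemma icoef_mono n c a l :
  icoef (monomial c a : iter_laurent A n) l = if l == a then c else 0.
Proof.
elim: n c a l => [|n IHn] c a l /=; first by rewrite (flatmx0 l) (flatmx0 a) eqxx.
case: eqP => la; last first.
  rewrite -[LHS]/(icoef (0 : iter_laurent A n) _) icoef0 ifF //.
  by apply/eqP => E; apply: la; rewrite E.
rewrite IHn; congr (if _ then _ else _); apply/eqP/eqP => [E|-> //].
by rewrite -(exp_consK l) la E exp_consK.
Qed.

Lemma monomialM n c c' a a' :
  monomial c a * monomial c' a' = monomial (c * c') (a + a') :> iter_laurent A n.
Proof.
apply: icoef_ext => l; rewrite icoef_monoM !icoef_mono subr_eq addrC.
by case: ifP; rewrite ?mulr0.
Qed.

Lemma monomial0 n a : monomial 0 a = 0 :> iter_laurent A n.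
Proof. by apply: icoef_ext => l; rewrite icoef_mono icoef0; case: ifP. Qed.

Lemma monomial1 n : monomial 1 0 = 1 :> iter_laurent A n.
Proof.
elim: n => [//|n IHn] /=; rewrite mxE.
have -> : row' ord_max (0 : 'cV[int]_n.+1) = 0 by apply/colP => j; rewrite !mxE.
by rewrite IHn.
Qed.

Lemma constL_is_zmod_morphism n : zmod_morphism (@constL A n).
Proof.
move=> a b; apply: icoef_ext => l; rewrite icoefB !icoef_mono.
by case: ifP; rewrite ?subr0.
Qed.

Lemma constL_is_monoid_morphism n : monoid_morphism (@constL A n).
Proof. by split=> [|a b]; rewrite /constL ?monomial1 // monomialM addr0. Qed.

HB.instance Definition _ n := GRing.isZmodMorphism.Build A (iter_laurent A n)
  (@constL A n) (@constL_is_zmod_morphism n).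
HB.instance Definition _ n := GRing.isMonoidMorphism.Build A (iter_laurent A n)
  (@constL A n) (@constL_is_monoid_morphism n).

Lemma icoef_constM n c (f : iter_laurent A n) l :
  icoef (constL n c * f) l = c * icoef f l.
Proof. by rewrite icoef_monoM subr0. Qed.

Lemma monomialE n (c : A) a : monomial c a = constL n c * monomial 1 a.
Proof. by rewrite /constL monomialM mulr1 add0r. Qed.

Lemma monomialVr n (a : 'cV[int]_n) : monomial (1 : A) a * monomial 1 (- a) = 1.
Proof. by rewrite monomialM mulr1 subrr monomial1. Qed.

End Coefficients.

Section GoodFunctionals.
Variable A : comPzRingType.

(** For additive T this is continuity into the discrete group V. *)
Definition vanishes_near0 (n : nat) (V : zmodType) (T : iter_laurent A n -> V) :=
  exists lam, forall f, Ulambda lam f -> T f = 0.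

Lemma vanishes_near0_ext n (V : zmodType) (T T' : iter_laurent A n -> V) :
  T =1 T' -> vanishes_near0 T -> vanishes_near0 T'.
Proof. by move=> TT' [lam T0]; exists lam => f /T0; rewrite TT'. Qed.

Lemma vanishes_near0D n (V : zmodType) (T T' : iter_laurent A n -> V) :
  vanishes_near0 T -> vanishes_near0 T' -> vanishes_near0 (fun f => T f + T' f).
Proof.
move=> [lam T0] [mu T'0]; exists (Lambda_min lam mu) => f.
by move=> /Ulambda_min[/T0 -> /T'0 ->]; rewrite addr0.
Qed.

Lemma vanishes_near0_sum n (V : zmodType) (I : Type) (r : seq I)
    (T : I -> iter_laurent A n -> V) :
  (forall i, vanishes_near0 (T i)) -> vanishes_near0 (fun f => \sum_(i <- r) T i f).
Proof.
move=> T0; elim: r => [|i r IHr].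
  by exists (Lambda0 n) => f _; rewrite big_nil.
by apply: vanishes_near0_ext (vanishes_near0D (T0 i) IHr) => f; rewrite big_cons.
Qed.

Lemma vanishes_near0_comp n (V W : zmodType) (T : iter_laurent A n -> V)
    (h : V -> W) :
  h 0 = 0 -> vanishes_near0 T -> vanishes_near0 (fun f => h (T f)).
Proof. by move=> h0 [lam T0]; exists lam => f /T0 ->. Qed.

Lemma Ulambda_lcoef n (lam : Lambda n.+1) (f : iter_laurent A n.+1) k :
  Ulambda lam f -> lam.2 <= - k ->
  Ulambda (lam.1 (- k)) ((f : laurent (iter_laurent_ring A n)) k : iter_laurent A n).
Proof.
move=> Uf lamk l Zl; have := Uf (exp_cons k l).
rewrite /= exp_cons_max row'_exp_cons; apply.
by rewrite linearN /= row'_exp_cons !mxE unlift_none.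
Qed.

(** If P has no terms of outer exponent below N, the outer coefficient k of f * P sees only the
    coefficients of f at exponents at most k - N, which gives the outer threshold; each of them
    meets one coefficient of P, to which the induction applies. *)
Lemma vanishes_near0_icoefM n (P : iter_laurent A n) l :
  vanishes_near0 (fun f => icoef (f * P) l).
Proof.
elim: n P l => [|n IHn] P l; first by exists tt => f Uf; rewrite [f](Uf 0 I) mul0r icoef0.
pose R := iter_laurent_ring A n; pose Pc : int -> iter_laurent A n := P : laurent R.
set k := l ord_max 0; set l' := row' ord_max l.
have [N PN] := laurent_bound (P : laurent R).
(* [Ulambda] constrains exponents through their negatives, so the bound indexed by j is the one for
   the coefficient of f at - j, which meets P at k + j. *)
have /choice[mu muP] (j : int) := IHn (Pc (k + j)) l'.
exists (mu, - (k - N)) => f Uf.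
rewrite -[LHS]/(icoef (((f : laurent R) * (P : laurent R)) k : iter_laurent A n) l').
have [M fM] := laurent_bound (f : laurent R).
rewrite (@lcoefM_fin _ f P k M N (absz (k - N - M)%R).+1 M) //; last by lia.
rewrite -[LHS]/(icoef (_ : iter_laurent A n) l') icoef_sum big1 // => i _.
have [ki|ik] := ltP (k - M - i%:Z) N.
  by rewrite PN // mulr0 icoef0.
have := muP (- (M + i%:Z)) _ (Ulambda_lcoef (k := M + i%:Z) Uf _).
rewrite /Pc (_ : k + - (M + i%:Z) = k - M - i%:Z); last by lia.
by apply; rewrite /=; lia.
Qed.

(** Density of the finite sums of monomials. T ignores everything of outer exponent above - lam.2,
    and f has only finitely many coefficients up to there; each exponent defines a functional of the
    inner series, settled by induction. *)
Lemma monomial_functional_ext n (V : zmodType) (T : iter_laurent A n -> V) :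
  zmod_morphism T -> vanishes_near0 T -> (forall c l, T (monomial c l) = 0) -> forall f, T f = 0.
Proof.
elim: n V T => [|n IHn] V T TB [lam T0] Tm f.
  exact: (Tm f 0).
pose T' : {additive iter_laurent A n.+1 -> V} := HB.pack T
  (GRing.isZmodMorphism.Build _ _ T TB).
pose R := iter_laurent_ring A n.
pose S k (r : R) : V := T (lmono r k).
have Sadd k : zmod_morphism (S k) by move=> r s; rewrite /S lmonoB; apply: TB.
have S0 k (r : R) : k <= - lam.2 -> S k r = 0.
  move=> kl.
  apply: (IHn V (S k) (Sadd k)) => [|c l].
    exists (lam.1 (- k)) => g Ug; apply: T0 => l [/= + Zl].
    rewrite !mxE => lamk; case: eqP => [lk|_]; last exact: icoef0.
    rewrite [LHS]Ug //; move: Zl; rewrite mxE lk (_ : row' _ _ = - row' ord_max l) //.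
    by apply/colP => j; rewrite !mxE.
  have := Tm c (exp_cons k l).
  by rewrite /= row'_exp_cons exp_cons_max.
have [N fN] := laurent_bound (f : laurent R).
(* When f starts above - lam.2, the absolute value yields terms beyond that bound; they lie in
   [Ulambda lam] and T kills them. *)
pose m := (absz (- lam.2 - N)%R).+1.
pose g : laurent R := \sum_(i < m) lmono ((f : laurent R) (N + i%:Z)) (N + i%:Z).
have gE k : k <= - lam.2 -> g k = (f : laurent R) k.
  move=> kl; rewrite lcoef_sum /=.
  have [kN|Nk] := ltP k N.
    rewrite fN // big1 // => i _; case: eqP => // E; lia.
  have km : (absz (k - N)%R < m)%N by rewrite /m; lia.
  rewrite (bigD1 (Ordinal km)) //= ifT; last by apply/eqP; lia.
  rewrite big1 ?addr0 => [|i /eqP ik]; first by congr ((f : laurent R) _); lia.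
  by case: eqP => // E; case: ik; apply/val_inj => /=; lia.
have Tfg : T (f - g) = 0.
  apply: T0 => l [/= + Zl]; rewrite mxE => ll.
  rewrite -[LHS]/(icoef ((f : laurent R) (l ord_max 0) - g (l ord_max 0) : iter_laurent A n) _).
  by rewrite gE ?subrr ?icoef0 // lerNr.
have := TB f g; rewrite Tfg => /esym/eqP; rewrite subr_eq0 => /eqP ->.
rewrite -[T g]/(T' g) raddf_sum big1 //= => i _.
have [il|li] := leP (N + i%:Z) (- lam.2); first exact: S0.
apply: T0 => l [/= + Zl]; rewrite mxE => ll.
case: eqP => [E|_]; last exact: icoef0.
by move: li; rewrite -E ltNge => /negP[]; rewrite lerNr.
Qed.

End GoodFunctionals.

(** * Derivations *)

Section Derivations.
Variable A : comPzRingType.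

Lemma icoef_pderiv n (j : 'I_n) (f : iter_laurent A n) l :
  icoef (pderiv j f) l = icoef f (l + delta_mx j 0) *~ (l j 0 + 1).
Proof.
elim: n j f l => [[] //|n IHn] j f l.
rewrite /pderiv /=; case: unliftP => [i|] -> /=.
  rewrite [LHS]IHn !mxE eqxx (negPf (neq_lift _ _)) addr0.
  congr (icoef _ _ *~ _); apply/colP => k; rewrite !mxE.
  by rewrite (inj_eq lift_inj).
rewrite [LHS]icoefMz !mxE !eqxx; congr (icoef _ _ *~ _).
by apply/colP => k; rewrite !mxE (eq_sym (lift _ _)) (negPf (neq_lift _ _)) addr0.
Qed.

(** The Euler operator t_j d/dt_j: unlike d/dt_j it shifts no exponent, so it preserves each
    [Ulambda] and has the monomials as eigenvectors. *)
Definition eulerd n (j : 'I_n) (f : iter_laurent A n) : iter_laurent A n :=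
  tvar A j * pderiv j f.

Lemma icoef_eulerd n (j : 'I_n) (f : iter_laurent A n) l :
  icoef (eulerd j f) l = icoef f l *~ (l j 0).
Proof.
by rewrite icoef_monoM mul1r icoef_pderiv subrK !mxE !eqxx subrK.
Qed.

Lemma eulerd_is_zmod_morphism n (j : 'I_n) : zmod_morphism (eulerd j).
Proof. by move=> f g; apply: icoef_ext => l; rewrite icoefB !icoef_eulerd icoefB mulrzBl. Qed.

HB.instance Definition _ n (j : 'I_n) := GRing.isZmodMorphism.Build
  (iter_laurent A n) (iter_laurent A n) (eulerd j) (eulerd_is_zmod_morphism j).

Lemma eulerd_mono n (j : 'I_n) c a :
  eulerd j (monomial c a) = monomial c a *~ a j 0.
Proof.
apply: icoef_ext => l; rewrite icoef_eulerd icoefMz icoef_mono.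
by case: eqP => [->|] //; rewrite !mul0rz.
Qed.

Lemma vanishes_near0_icoef n l : vanishes_near0 (fun f : iter_laurent A n => icoef f l).
Proof. by apply: vanishes_near0_ext (vanishes_near0_icoefM 1 l) => f; rewrite mulr1. Qed.

Lemma vanishes_near0_eulerd n (j : 'I_n) (V : zmodType) (T : iter_laurent A n -> V) :
  vanishes_near0 T -> vanishes_near0 (fun f => T (eulerd j f)).
Proof.
move=> [lam T0]; exists lam => f Uf; apply: T0 => l Zl.
by rewrite icoef_eulerd Uf ?mul0rz.
Qed.

(** The Leibniz defect is biadditive, symmetric and continuous in each argument, so density reduces
    it to two monomials, where it says that exponents add. *)
Lemma eulerdM n (j : 'I_n) (f g : iter_laurent A n) :
  eulerd j (f * g) = eulerd j f * g + f * eulerd j g.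
Proof.
pose T f g := eulerd j (f * g) - (eulerd j f * g + f * eulerd j g).
suff T0 f' g' : T f' g' = 0 by apply/eqP; rewrite -subr_eq0 -/(T f g) T0.
have TC f1 g1 : T f1 g1 = T g1 f1.
  by rewrite /T (mulrC f1 g1) (mulrC _ g1) (mulrC f1) [X in _ - X]addrC.
have TB g1 : zmod_morphism (T^~ g1).
  by move=> f1 f2; rewrite /T !(mulrBl, raddfB) /=; ring.
have Tvan g1 l : vanishes_near0 (fun f => icoef (T f g1) l).
  apply: (@vanishes_near0_ext _ _ _ (fun f1 => icoef (f1 * g1) l *~ l j 0 +
    (- icoef (eulerd j f1 * g1) l + - icoef (f1 * eulerd j g1) l))).
    by move=> f1; rewrite /T icoefB icoefD icoef_eulerd opprD.
  apply: vanishes_near0D.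
    apply: (vanishes_near0_comp (h := fun x => x *~ l j 0)); first exact: mul0rz.
    exact: vanishes_near0_icoefM.
  apply: vanishes_near0D.
    apply: (vanishes_near0_comp (h := -%R)); first exact: oppr0.
    exact: (vanishes_near0_eulerd _ (vanishes_near0_icoefM _ _)).
  apply: (vanishes_near0_comp (h := -%R)); first exact: oppr0.
  exact: vanishes_near0_icoefM.
have step g1 : (forall c a, T (monomial c a) g1 = 0) -> forall f1, T f1 g1 = 0.
  move=> Tm f1; apply: icoef_ext => l; rewrite icoef0; move: f1.
  apply: monomial_functional_ext => [f1 f2||c a]; last by rewrite Tm icoef0.
    by rewrite TB icoefB.
  exact: Tvan.
apply: (step) => c a; rewrite TC; apply: (step) => c' a'.
rewrite /T !monomialM !eulerd_mono mxE.
by rewrite mulrzAl mulrzAr !monomialM -mulrzDr subrr.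
Qed.

Lemma eulerd1 n (j : 'I_n) : eulerd j 1 = 0 :> iter_laurent A n.
Proof. by rewrite -monomial1 eulerd_mono mxE mulr0z. Qed.

Lemma eulerdX n (j : 'I_n) (f : iter_laurent A n) k :
  eulerd j (f ^+ k.+1) = (f ^+ k * eulerd j f) *+ k.+1.
Proof.
elim: k => [|k IHk]; first by rewrite !expr1 expr0 mul1r mulr1n.
rewrite exprS eulerdM IHk mulrnAr mulrA -exprS [RHS]mulrS.
by rewrite (mulrC (eulerd j f)).
Qed.

Lemma eulerd_constM n (j : 'I_n) c (f : iter_laurent A n) :
  eulerd j (constL n c * f) = constL n c * eulerd j f.
Proof. by rewrite eulerdM eulerd_mono mxE mulr0z mul0r add0r. Qed.

Lemma tvarV n (j : 'I_n) : monomial 1 (- delta_mx j 0) * tvar A j = 1.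
Proof. by rewrite mulrC monomialVr. Qed.

Lemma pderivE n (j : 'I_n) (f : iter_laurent A n) :
  pderiv j f = monomial 1 (- delta_mx j 0) * eulerd j f.
Proof. by rewrite mulrA tvarV mul1r. Qed.

Lemma pderiv_is_zmod_morphism n (j : 'I_n) : zmod_morphism (@pderiv A n j).
Proof. by move=> f g; apply: raddfB. Qed.

HB.instance Definition _ n (j : 'I_n) := GRing.isZmodMorphism.Build
  (iter_laurent A n) (iter_laurent A n) (@pderiv A n j)
  (pderiv_is_zmod_morphism j).

Lemma pderivM n (j : 'I_n) (f g : iter_laurent A n) :
  pderiv j (f * g) = pderiv j f * g + f * pderiv j g.
Proof. by rewrite !pderivE eulerdM; ring. Qed.

Lemma pderiv_tvar n (i j : 'I_n) : pderiv j (tvar A i) = (j == i)%:R.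
Proof.
rewrite pderivE eulerd_mono mulrzAr monomialM mulr1 mxE eqxx andbT.
case: eqP => [->|_]; last by rewrite mulr0z.
by rewrite addrC subrr monomial1.
Qed.

End Derivations.

(** * Differential forms *)

Definition upd (n : nat) (T : Type) (w : 'I_n -> T) (k : 'I_n) (x : T) : 'I_n -> T :=
  fun i => if i == k then x else w i.

Section Update.
Variables (n : nat) (T : Type).
Implicit Types (w : 'I_n -> T) (k : 'I_n) (x : T).

Lemma upd_same w k x : upd w k x k = x. Proof. by rewrite /upd eqxx. Qed.

Lemma upd_other w k x i : i != k -> upd w k x i = w i.
Proof. by rewrite /upd => /negPf ->. Qed.

Lemma upd_id w k : upd w k (w k) = w.
Proof. by apply: funext => i; rewrite /upd; case: eqP => [->|]. Qed.

Lemma updC w k k' x y : k != k' -> upd (upd w k x) k' y = upd (upd w k' y) k x.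
Proof.
move=> kk'; apply: funext => i; rewrite /upd.
by case: (i =P k') => [->|//]; rewrite eq_sym (negPf kk').
Qed.

End Update.

(** * Alternating multilinear maps *)

Section Alternating.
Variables (R : comPzRingType) (n : nat) (N : lmodType R).
Variable F : ('I_n -> 'rV[R]_n) -> N.
Hypothesis F_lin : forall w k a u v,
  F (upd w k (a *: u + v)) = a *: F (upd w k u) + F (upd w k v).
Hypothesis F_alt : forall (i j : 'I_n) w, i != j -> w i = w j -> F w = 0.

Let F_upd0 w k : F (upd w k 0) = 0.
Proof.
have := F_lin w k 1 0 0; rewrite scaler0 addr0 scale1r => /eqP.
by rewrite -subr_eq subrr => /eqP.
Qed.

Let F_updD w k u v : F (upd w k (u + v)) = F (upd w k u) + F (upd w k v).
Proof. by have := F_lin w k 1 u v; rewrite !scale1r. Qed.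

Let F_swap (i j : 'I_n) w a b : i != j ->
  F (upd (upd w i a) j b) = - F (upd (upd w i b) j a).
Proof.
move=> ij; apply/eqP; rewrite -addr_eq0.
have F2 c : F (upd (upd w i c) j c) = 0.
  by apply: (F_alt ij); rewrite upd_same upd_other // upd_same.
have := F2 (a + b); rewrite F_updD !(updC _ _ _ ij) !F_updD -!(updC _ _ _ ij).
by rewrite !F2 add0r addr0 addrC => ->.
Qed.

(** Each argument is expanded in the standard basis. The remaining families of basis vectors give 0
    when one repeats, and otherwise differ from the standard family by transpositions, each a change
    of sign. *)
Lemma alternating_eq0 : F (fun i => delta_mx 0 i) = 0 -> forall w, F w = 0.
Proof.
move=> F1.
have Fperm (s : 'S_n) : F (fun i => delta_mx 0 (s i)) = 0.
  have [ts -> _] := prod_tpermP s; elim: ts => [|t ts IHts].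
    by rewrite big_nil -[RHS]F1; congr F; apply: funext => i; rewrite perm1.
  rewrite big_cons; set p := (\prod_(_ <- _) _)%g in IHts *.
  have [tt|tt] := eqVneq t.1 t.2.
    by rewrite tt tperm1 mul1g.
  pose w i : 'rV[R]_n := delta_mx 0 (p i).
  have -> : (fun i => delta_mx 0 ((tperm t.1 t.2 * p)%g i)) =
      upd (upd w t.1 (w t.2)) t.2 (w t.1).
    apply: funext => i; rewrite /upd permM; case: tpermP => [->|->|].
    - by rewrite eqxx (negPf tt).
    - by rewrite eqxx.
    by move=> /eqP/negPf -> /eqP/negPf ->.
  by rewrite F_swap // !upd_id IHts oppr0.
have Ffun (f : 'I_n -> 'I_n) : F (fun i => delta_mx 0 (f i)) = 0.
  have [/injectiveP f_inj|/injectivePn[i [j ij fij]]] := boolP (injectiveb f).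
    by rewrite -(Fperm (perm f_inj)); congr F; apply: funext => i; rewrite permE.
  by apply: (F_alt ij); rewrite fij.
(* Induction on the number k of leading arguments still arbitrary: those from k on are already basis
   vectors. *)
suff FP (k : nat) w : (forall i : 'I_n, (k <= i)%N -> exists j, w i = delta_mx 0 j) ->
    F w = 0.
  by move=> w; apply: (FP n) => i; rewrite leqNgt ltn_ord.
elim: k w => [|k IHk] w wk.
  have /choice[f fP] (i : 'I_n) : exists j, w i = delta_mx 0 j by apply: wk.
  by rewrite -(Ffun f); congr F; apply: funext.
have [kn|nk] := ltnP k n; last first.
  by apply: IHk => i ki; have := ltn_ord i; rewrite ltnNge (leq_trans nk).
pose k0 := Ordinal kn.
have FS (r : seq 'I_n) : F (upd w k0 (\sum_(j <- r) w k0 0 j *: delta_mx 0 j)) = 0.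
  elim: r => [|j r IHr]; first by rewrite big_nil F_upd0.
  rewrite big_cons F_lin IHr addr0 IHk ?scaler0 // => i ki.
  have [->|ik] := eqVneq i k0; first by exists j; rewrite upd_same.
  rewrite upd_other //; apply: wk.
  by rewrite ltn_neqAle ki andbT eq_sym; apply: contraNneq ik => E; apply/eqP/val_inj.
by rewrite -[w](upd_id _ k0) [X in upd _ _ X]row_sum_delta FS.
Qed.

End Alternating.

(** * Linear maps out of free and quotient modules *)

Section FreeQuotient.
Variables (R : comPzRingType).

Definition scalar_map (M : lmodType R) (F : M -> R) :=
  forall a x y, F (a *: x + y) = a * F x + F y.

Definition free_ext (G : choiceType) (F : G -> R) (x : free_mod R G) : R :=
  \sum_(g \in [set: G]%classic) free_coef x g * F g.

Lemma free_extE (G : choiceType) (F : G -> R) (x : free_mod R G) (r : {fset G}) :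
  (forall g, g \notin r -> free_coef x g = 0) ->
  free_ext F x = \sum_(g <- r) free_coef x g * F g.
Proof. by move=> x0; rewrite /free_ext (fsbigTE r) // => g /x0 ->; rewrite mul0r. Qed.

Lemma free_support (G : choiceType) (x : free_mod R G) :
  exists r : {fset G}, forall g, g \notin r -> free_coef x g = 0.
Proof.
have /asboolP/finite_fsetP[r xr] := valP x; exists r => g.
apply: contraNeq => xg; have : [set` r]%classic g by rewrite -xr.
by [].
Qed.

Lemma free_coef_lin (G : choiceType) a (x y : free_mod R G) g :
  free_coef (a *: x + y) g = a * free_coef x g + free_coef y g.
Proof. by []. Qed.

Lemma free_ext_scalar (G : choiceType) (F : G -> R) : scalar_map (free_ext F).
Proof.
move=> a x y; have [[r xr] [s ys]] := (free_support x, free_support y).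
have out g : g \notin (r `|` s)%fset -> free_coef x g = 0 /\ free_coef y g = 0.
  by rewrite in_fsetU => /norP[/xr -> /ys ->].
rewrite !(@free_extE _ _ _ (r `|` s)%fset).
- rewrite mulr_sumr -big_split /=; apply: eq_bigr => g _.
  by rewrite -[X in X * _]/(a * free_coef x g + free_coef y g) mulrDl mulrA.
- by move=> g /out[].
- by move=> g /out[].
- by move=> g /out[xg yg]; rewrite free_coef_lin xg yg mulr0 addr0.
Qed.

Lemma free_ext_gen (G : choiceType) (F : G -> R) g : free_ext F (free_gen R g) = F g.
Proof.
rewrite (@free_extE _ _ _ [fset g]%fset) => [|h].
  by rewrite big_seq_fset1 /= eqxx mul1r.
by rewrite in_fset1 /= => /negPf ->.
Qed.

Variables (M : lmodType R) (S : set M).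

Definition quot_ext (F : M -> R) (x : quot_mod S) : R :=
  F (generic_quotient.repr (x : Quotient.quot (gen_submod S))).

Variable F : M -> R.
Hypothesis F_lin : scalar_map F.
Hypothesis F_S : forall x, S x -> F x = 0.

(** F kills the span of S, so its value at the chosen representative depends only on the class. *)
Lemma quot_extE x : quot_ext F (quot_pi S x) = F x.
Proof.
have F0 : F 0 = 0.
  have := F_lin 1 0 0; rewrite scaler0 addr0 mul1r => /eqP.
  by rewrite -subr_eq subrr => /eqP.
have span0 y : in_span S y -> F y = 0.
  elim=> [//|z /F_S //|a y' z _ Fy _ Fz].
  by rewrite F_lin Fy Fz mulr0 addr0.
have /quot_piP/asboolP/span0 : quot_pi S (generic_quotient.repr (quot_pi S x : Quotient.quot (gen_submod S)))
  = quot_pi S x by rewrite quot_piK.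
rewrite /quot_ext => FB; set y := generic_quotient.repr _ in FB *.
have := F_lin 1 (y - x) x; rewrite scale1r subrK mul1r FB add0r.
by [].
Qed.

Lemma quot_ext_scalar : scalar_map (quot_ext F).
Proof.
move=> a x y; rewrite -[x in LHS]quot_piK -[y in LHS]quot_piK.
have -> : a *: quot_pi S (generic_quotient.repr x) = quot_pi S (a *: generic_quotient.repr x) := quot_scaleE S a _.
by rewrite -quot_piD quot_extE F_lin.
Qed.

Lemma quot_piZ a x : a *: quot_pi S x = quot_pi S (a *: x).
Proof. exact: quot_scaleE. Qed.

Lemma quot_pi_is_zmod_morphism : zmod_morphism (quot_pi S).
Proof. by move=> x y; apply: (addIr (quot_pi S y)); rewrite -quot_piD !subrK. Qed.

Lemma quot_pi_gen0 x : S x -> quot_pi S x = 0.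
Proof.
move=> Sx; rewrite -(subrr (quot_pi S x)) -quot_pi_is_zmod_morphism subrr.
by apply/quot_piP; rewrite subr0; apply/asboolP/in_span_gen.
Qed.

End FreeQuotient.

Section ScalarMapTheory.
Variables (R : comPzRingType) (M : lmodType R) (F : M -> R).
Hypothesis F_lin : scalar_map F.

Lemma scalar_map0 : F 0 = 0.
Proof.
have := F_lin 1 0 0; rewrite scaler0 addr0 mul1r => /eqP.
by rewrite -subr_eq subrr => /eqP.
Qed.

Lemma scalar_mapZ a x : F (a *: x) = a * F x.
Proof. by rewrite -[a *: x]addr0 F_lin scalar_map0 addr0. Qed.

Lemma scalar_mapD x y : F (x + y) = F x + F y.
Proof. by rewrite -[x in LHS]scale1r F_lin mul1r. Qed.

Lemma scalar_mapB x y : F (x - y) = F x - F y.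
Proof. by apply: (addIr (F y)); rewrite -scalar_mapD !subrK. Qed.

Lemma scalar_map_sum (I : Type) (r : seq I) (G : I -> M) :
  F (\sum_(i <- r) G i) = \sum_(i <- r) F (G i).
Proof. exact: (big_morph F scalar_mapD scalar_map0). Qed.

End ScalarMapTheory.

Lemma scale_sub_lin (R : comPzRingType) (M : lmodType R) (a b c : R) (x y z : M) :
  a *: x + y - (a * b + c) *: z = a *: (x - b *: z) + (y - c *: z).
Proof. by rewrite scalerBr scalerDl -scalerA opprD addrACA. Qed.

Section Forms.
Variables (A : comPzRingType) (n : nat).
Local Notation L := (iter_laurent A n).

Definition kahler_pderiv (j : 'I_n) : kahler L -> L :=
  quot_ext (free_ext (pderiv j : L -> L)).

Lemma kahler_pderiv_rel j x : kahler_rel x -> free_ext (pderiv j : L -> L) x = 0.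
Proof.
have lin := free_ext_scalar (pderiv j : L -> L).
move=> [f [g [->|->]]]; rewrite !(scalar_mapB lin) ?(scalar_mapZ lin) !free_ext_gen.
  by rewrite raddfD /=; ring.
by rewrite pderivM; ring.
Qed.

Lemma kahler_pderiv_scalar j : scalar_map (kahler_pderiv j).
Proof. exact: (quot_ext_scalar (free_ext_scalar _) (@kahler_pderiv_rel j)). Qed.

Lemma kahler_pderivE j f : kahler_pderiv j (kahler_d f) = pderiv j f.
Proof.
rewrite /kahler_pderiv /kahler_d.
rewrite (quot_extE (free_ext_scalar _) (@kahler_pderiv_rel j)).
exact: free_ext_gen.
Qed.

(** The coefficient along dt_j, obtained from the derivation d/dt_j through the two quotients that
    define the forms. *)
Definition omega1_coord (j : 'I_n) : omega1 A n -> L := quot_ext (kahler_pderiv j).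

Lemma omega1_coord_rel j x : omega1_rel x -> kahler_pderiv j x = 0.
Proof.
have lin := kahler_pderiv_scalar j.
move=> [f ->]; rewrite (scalar_mapB lin) (scalar_map_sum lin) kahler_pderivE.
rewrite (bigD1 j) //= big1 => [|i ij].
  by rewrite (scalar_mapZ lin) kahler_pderivE pderiv_tvar eqxx mulr1 addr0 subrr.
by rewrite (scalar_mapZ lin) kahler_pderivE pderiv_tvar eq_sym (negPf ij) mulr0.
Qed.

Lemma omega1_coord_scalar j : scalar_map (omega1_coord j).
Proof. exact: (quot_ext_scalar (kahler_pderiv_scalar j) (@omega1_coord_rel j)). Qed.

Lemma omega1_coordE j f : omega1_coord j (d1 f) = pderiv j f.
Proof.
rewrite /omega1_coord /d1.
by rewrite (quot_extE (kahler_pderiv_scalar j) (@omega1_coord_rel j)) kahler_pderivE.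
Qed.

Lemma d1E (f : L) : d1 f = \sum_(i < n) pderiv i f *: d1 (tvar A i).
Proof.
have piB := quot_pi_is_zmod_morphism (@omega1_rel A n).
have piD := quot_piD (@omega1_rel A n).
apply/eqP; rewrite -subr_eq0; apply/eqP.
transitivity (quot_pi (@omega1_rel A n)
  (kahler_d f - \sum_(i < n) pderiv i f *: kahler_d (tvar A i))); last first.
  by apply: quot_pi_gen0; exists f.
rewrite piB; congr (_ - _).
rewrite (big_morph _ piD (id1 := 0)); last by have := piB 0 0; rewrite !subrr.
by apply: eq_bigr => i _; rewrite -quot_piZ.
Qed.

Definition coord_mx (w : 'I_n -> omega1 A n) : 'M[L]_n :=
  \matrix_(i, j) omega1_coord j (w i).

Definition coord_det (w : 'I_n -> omega1 A n) : L := \det (coord_mx w).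

(** It takes the value 1 on [dt_wedge], hence reads off the coefficient f of f dt_1 ... dt_n and
    makes that coefficient unique. *)
Definition omegan_coord : omegan A n -> L := quot_ext (free_ext coord_det).

Lemma omegan_coord_rel x : ext_rel x -> free_ext coord_det x = 0.
Proof.
have lin := free_ext_scalar coord_det.
move=> [[a [i [u [v [w [wuv wi ->]]]]]]|[i [j [w [ij wij ->]]]]].
  rewrite !(scalar_mapB lin) (scalar_mapZ lin) !free_ext_gen.
  have -> : coord_det w = a * coord_det u + 1 * coord_det v.
    apply: (determinant_multilinear (i0 := i)).
    - apply/rowP => j; rewrite !mxE wi mul1r; exact: omega1_coord_scalar.
    - apply/matrixP => k j; rewrite !mxE.
      by have [|->] := wuv (lift i k); rewrite // eq_sym neq_lift.
    apply/matrixP => k j; rewrite !mxE.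
    by have [|_ ->] := wuv (lift i k); rewrite // eq_sym neq_lift.
  by ring.
rewrite free_ext_gen; apply: (determinant_alternate ij) => k.
by rewrite !mxE wij.
Qed.

Lemma omegan_coord_scalar : scalar_map omegan_coord.
Proof. exact: (quot_ext_scalar (free_ext_scalar _) omegan_coord_rel). Qed.

Lemma omegan_coord_wedge (w : 'I_n -> omega1 A n) :
  omegan_coord (wedge w) = \det (coord_mx w).
Proof.
rewrite /omegan_coord /wedge.
by rewrite (quot_extE (free_ext_scalar _) omegan_coord_rel) free_ext_gen.
Qed.

Lemma form_coef_dt (f : L) : form_coef (f *: dt_wedge A n) = f.
Proof.
have coordE g : omegan_coord (g *: dt_wedge A n) = g.
  rewrite (scalar_mapZ omegan_coord_scalar) omegan_coord_wedge.
  rewrite (_ : coord_mx _ = 1%:M) ?det1 ?mulr1 //.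
  by apply/matrixP => i j; rewrite !mxE omega1_coordE pderiv_tvar eq_sym.
rewrite /form_coef; case: xgetP => [g _ /= /(congr1 omegan_coord)|].
  by rewrite !coordE.
by move=> /(_ f) /(_ erefl).
Qed.

Lemma wedge_lin (u : 'I_n -> omega1 A n) k (a : L) x y :
  wedge (upd u k (a *: x + y)) = a *: wedge (upd u k x) + wedge (upd u k y).
Proof.
pose S := @ext_rel L (omega1 A n) n.
have piB := quot_pi_is_zmod_morphism S.
pose g w := @free_gen L ('I_n -> omega1 A n) w.
have rel0 : quot_pi S (g (upd u k (a *: x + y)) - a *: g (upd u k x) - g (upd u k y)) = 0.
  apply: quot_pi_gen0; left.
  exists a, k, (upd u k x), (upd u k y), (upd u k (a *: x + y)); split=> //.
    by move=> j jk; rewrite !upd_other.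
  by rewrite !upd_same.
move/eqP: rel0; rewrite !piB -quot_piZ !subr_eq add0r => /eqP E; rewrite [RHS]addrC; exact: E.
Qed.

Lemma wedge_alt (w : 'I_n -> omega1 A n) i j : i != j -> w i = w j -> wedge w = 0.
Proof. by move=> ij wij; apply: quot_pi_gen0; right; exists i, j, w. Qed.

(** Both sides are multilinear and alternating in the rows of M, so it is enough to compare them at
    the identity matrix. *)
Lemma wedge_mul (M : 'I_n -> 'rV[L]_n) (e : 'I_n -> omega1 A n) :
  wedge (fun i => \sum_j M i 0 j *: e j) = \det (\matrix_(i, j) M i 0 j) *: wedge e.
Proof.
pose c (v : 'rV[L]_n) := \sum_j v 0 j *: e j.
have c_lin a u v : c (a *: u + v) = a *: c u + c v.
  rewrite /c scaler_sumr -big_split /=; apply: eq_bigr => j _.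
  by rewrite !mxE scalerDl scalerA.
pose F (w : 'I_n -> 'rV[L]_n) : omegan A n :=
  wedge (fun i => c (w i)) - \det (\matrix_(i, j) w i 0 j) *: wedge e.
have cupd (w : 'I_n -> 'rV[L]_n) k x :
    (fun i => c (upd w k x i)) = upd (fun i => c (w i)) k (c x).
  by apply: funext => i; rewrite /upd; case: ifP.
have wedge_c_lin (w : 'I_n -> 'rV[L]_n) k a u v : wedge (fun i => c (upd w k (a *: u + v) i)) =
    a *: wedge (fun i => c (upd w k u i)) + wedge (fun i => c (upd w k v i)).
  have E1 := congr1 (@wedge L (omega1 A n) n) (etrans (cupd w k (a *: u + v)) (congr1 (upd _ k) (c_lin a u v))).
  have E2 := wedge_lin (fun i => c (w i)) k a (c u) (c v).
  have E3 := congr1 (@wedge L (omega1 A n) n) (cupd w k u).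
  have E4 := congr1 (@wedge L (omega1 A n) n) (cupd w k v).
  exact: (etrans E1 (etrans E2 (congr2 (fun x y => a *: x + y) (esym E3) (esym E4)))).
have det_lin (w : 'I_n -> 'rV[L]_n) k a u v : \det (\matrix_(i, j) upd w k (a *: u + v) i 0 j) =
    a * \det (\matrix_(i, j) upd w k u i 0 j) + \det (\matrix_(i, j) upd w k v i 0 j).
  rewrite -[X in _ = _ + X]mul1r; apply: (determinant_multilinear (i0 := k)).
  + by apply/rowP => j; rewrite !mxE !upd_same !mxE mul1r.
  + by apply/matrixP => i j; rewrite !mxE !upd_other // eq_sym neq_lift.
  by apply/matrixP => i j; rewrite !mxE !upd_other // eq_sym neq_lift.
suff F0 : F M = 0 by apply/eqP; rewrite -subr_eq0 -/(F M) F0.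
apply: alternating_eq0 => [w k a u v|i j w ij wij|]; rewrite /F.
- have E1 := wedge_c_lin w k a u v; have E2 := det_lin w k a u v.
  have E3 := congr2 (fun x d => x - d *: wedge e) E1 E2.
  apply: (etrans E3).
  exact: scale_sub_lin.
- rewrite (@wedge_alt _ i j) ?wij // sub0r.
  by rewrite (determinant_alternate ij) ?scale0r ?oppr0 // => k; rewrite !mxE wij.
rewrite (_ : \matrix_(i, j) _ = 1%:M); last first.
  by apply/matrixP => i j; rewrite !mxE eqxx andTb eq_sym.
rewrite det1 scale1r (_ : (fun i => _) = e) ?subrr //.
apply: funext => i; rewrite /c (bigD1 i) //= big1 ?addr0 => [|j /negPf ji].
  by rewrite mxE !eqxx scale1r.
by rewrite mxE ji andbF scale0r.
Qed.

Definition jacobian (g : 'I_n -> L) : L := \det (\matrix_(i, j) pderiv j (g i)).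

Lemma form_coef_wedge (f : L) (g : 'I_n -> L) :
  form_coef (f *: wedge (fun i => d1 (g i))) = f * jacobian g.
Proof.
have -> : wedge (fun i => d1 (g i)) = jacobian g *: dt_wedge A n.
  rewrite (_ : (fun i => d1 (g i)) =
      fun i => \sum_j (\row_j pderiv j (g i)) 0 j *: d1 (tvar A j)); last first.
    by apply: funext => i; rewrite d1E; apply: eq_bigr => j _; rewrite mxE.
  rewrite wedge_mul; congr (\det _ *: _).
  by apply/matrixP => i j; rewrite !mxE.
by rewrite scalerA form_coef_dt.
Qed.

Lemma res_form_map (phi : {rmorphism L -> L}) (omega : omegan A n) :
  res (form_map phi omega) =
    icoef (phi (form_coef omega) * jacobian (fun i => phi (tvar A i)))
      (const_mx (-1)).
Proof. by rewrite /res /form_map form_coef_wedge. Qed.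

End Forms.

(** * A torsion-free cover *)

Section TorsionFreeCover.
Variable A : comPzRingType.

Definition pointed_mul (x y : option A) : option A :=
  match x, y with
  | None, _ => y
  | _, None => x
  | Some a, Some b => Some (a * b)
  end.

Lemma pointed_mulA : associative pointed_mul.
Proof. by move=> [a|] [b|] [c|] //=; rewrite mulrA. Qed.

Lemma pointed_mul1m : left_id None pointed_mul. Proof. by []. Qed.

Lemma pointed_mulm1 : right_id None pointed_mul. Proof. by case. Qed.

Lemma pointed_unitm x y : pointed_mul x y = None -> x = None /\ y = None.
Proof. by case: x y => [a|] [b|]. Qed.

Lemma pointed_mulC : commutative pointed_mul.
Proof. by move=> [a|] [b|] //=; rewrite mulrC. Qed.

(* The multiplicative monoid of A with a new unit: [monomType] excludes
   nontrivial units. *)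
Definition pointed := option A.
HB.instance Definition _ := Choice.on pointed.
HB.instance Definition _ := Choice_isMonomialDef.Build pointed
  pointed_mulA pointed_mul1m pointed_mulm1 pointed_unitm.
HB.instance Definition _ := MonomialDef_isConomialDef.Build pointed pointed_mulC.

(** The integral monoid ring of [pointed]: additively free, hence torsion-free, and mapped onto A by
    evaluating each generator. *)
Definition tf_cover : comPzRingType := {malg int[pointed]}.

Definition pointed_val (x : pointed) : A := odflt 1 x.

Definition tf_cover_map (g : tf_cover) : A :=
  \sum_(k <- msupp (g : {malg int[pointed]})) pointed_val k *~ mcoeff k g.

Lemma tf_cover_mapEw (g : {malg int[pointed]}) (d : {fset pointed}) :
  (msupp g `<=` d)%fset ->
  tf_cover_map g = \sum_(k <- d) pointed_val k *~ mcoeff k g.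
Proof.
move=> le; rewrite [LHS](big_fset_incl _ le) => //= x xd /mcoeff_outdom ->.
by rewrite mulr0z.
Qed.

Lemma tf_cover_map_is_zmod_morphism : zmod_morphism tf_cover_map.
Proof.
move=> f g; pose d := (msupp f `|` msupp g)%fset.
rewrite (@tf_cover_mapEw _ d (msuppB_le _ _)) (@tf_cover_mapEw f d (fsubsetUl _ _)).
rewrite (@tf_cover_mapEw g d (fsubsetUr _ _)) -sumrB; apply: eq_bigr => k _.
by rewrite mcoeffB mulrzBr.
Qed.

HB.instance Definition _ := GRing.isZmodMorphism.Build tf_cover A tf_cover_map
  tf_cover_map_is_zmod_morphism.

Lemma tf_cover_mapU c (k : pointed) : tf_cover_map (mkmalgU k c) = pointed_val k *~ c.
Proof. by rewrite (tf_cover_mapEw msuppU_le) big_seq_fset1 mcoeffUU. Qed.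

Lemma tf_cover_map_is_monoid_morphism : monoid_morphism tf_cover_map.
Proof.
split=> [|f g]; first by rewrite [LHS]tf_cover_mapU.
rewrite -[f * g]/(fgmul f g) fgmull raddf_sum mulr_suml; apply: eq_bigr => k _.
rewrite raddf_sum mulr_sumr; apply: eq_bigr => k' _.
rewrite [LHS]tf_cover_mapU mulrzAl mulrzAr -mulrzA mulrC; congr (_ *~ _).
by case: k k' => [a|] [b|] //=; rewrite ?mul1r ?mulr1 // mulrC.
Qed.

HB.instance Definition _ := GRing.isMonoidMorphism.Build tf_cover A tf_cover_map
  tf_cover_map_is_monoid_morphism.

Lemma tf_cover_map_surj a : exists b, tf_cover_map b = a.
Proof. by exists (mkmalgU (Some a : pointed) 1); rewrite tf_cover_mapU. Qed.

Lemma tf_cover_torsion_free (b : tf_cover) k : b *+ k.+1 = 0 -> b = 0.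
Proof.
move=> bk; apply/malgP => x; have := congr1 (mcoeff x) bk.
by rewrite mcoeffMn mcoeff0 => /eqP; rewrite mulrn_eq0 /= => /eqP ->.
Qed.

End TorsionFreeCover.

(** * Functoriality of Laurent series in the coefficient ring *)

Section MapLaurent.
Variables (R S : comPzRingType) (h : {rmorphism R -> S}).

Fact laurent_map_subproof (f : laurent R) : (fun k => h (f k)) \in bounded_below S.
Proof.
have [N fN] := laurent_bound f.
by apply/bounded_belowP; exists N => k kN; rewrite fN ?raddf0.
Qed.

Definition laurent_map (f : laurent R) : laurent S := Laurent (laurent_map_subproof f).

Lemma laurent_map_is_zmod_morphism : zmod_morphism laurent_map.
Proof. by move=> f g; apply: laurentP => k; rewrite /= raddfB. Qed.

Lemma laurent_map_is_monoid_morphism : monoid_morphism laurent_map.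
Proof.
split=> [|f g]; apply: laurentP => k; rewrite /=.
  by case: ifP; rewrite ?rmorph1 ?rmorph0.
have [[N fN] [M gM]] := (laurent_bound f, laurent_bound g).
pose m := (absz (k - N - M)%R).+1.
rewrite !(@lconvE _ _ _ N M N m) //; rewrite /m; try lia.
- by rewrite rmorph_sum; apply: eq_bigr => i _; rewrite rmorphM.
- by move=> i iN /=; rewrite fN ?rmorph0.
by move=> i iM /=; rewrite gM ?rmorph0.
Qed.

HB.instance Definition _ := GRing.isZmodMorphism.Build (laurent R) (laurent S)
  laurent_map laurent_map_is_zmod_morphism.
HB.instance Definition _ := GRing.isMonoidMorphism.Build (laurent R) (laurent S)
  laurent_map laurent_map_is_monoid_morphism.

Lemma laurent_map_surj :
  (forall s, exists r, h r = s) -> forall g, exists f, laurent_map f = g.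
Proof.
move=> /choice[s sK] g.
(* A section of h need not send 0 to 0, so zero coefficients are lifted separately to keep the
   series bounded below. *)
have fP : (fun k => if g k == 0 then 0 else s (g k)) \in bounded_below R.
  have [N gN] := laurent_bound g; apply/bounded_belowP; exists N => k kN.
  by rewrite gN // eqxx.
exists (Laurent fP); apply: laurentP => k /=.
by case: eqP => [->|_]; rewrite ?rmorph0 ?sK.
Qed.

End MapLaurent.

Section MapIterated.
Variables (R S : comPzRingType) (h : {rmorphism R -> S}).

Fixpoint iter_map_rec (n : nat) :
    {rmorphism iter_laurent_ring R n -> iter_laurent_ring S n} :=
  match n return {rmorphism iter_laurent_ring R n -> iter_laurent_ring S n} with
  | 0 => h
  | n'.+1 => laurent_map (iter_map_rec n')
  end.

Definition iter_map n : {rmorphism iter_laurent R n -> iter_laurent S n} :=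
  iter_map_rec n.

Lemma icoef_iter_map n (f : iter_laurent R n) l :
  icoef (iter_map n f) l = h (icoef f l).
Proof. by elim: n f l => [//|n IHn] f l; apply: IHn. Qed.

Lemma iter_map_surj n : (forall s, exists r, h r = s) ->
  forall g : iter_laurent S n, exists f, iter_map n f = g.
Proof.
move=> hs; elim: n => [|n IHn]; first exact: hs.
exact: (@laurent_map_surj _ _ (iter_map_rec n) IHn).
Qed.

Lemma eulerd_iter_map n (j : 'I_n) (f : iter_laurent R n) :
  eulerd j (iter_map n f) = iter_map n (eulerd j f).
Proof.
by apply: icoef_ext => l; rewrite icoef_eulerd !icoef_iter_map icoef_eulerd rmorphMz.
Qed.

End MapIterated.

(** * The vanishing lemma *)

Section ResidueDeterminant.
Variables (A : comPzRingType) (n : nat).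
Local Notation L := (iter_laurent A n).
Implicit Types (w : 'I_n -> 'rV[L]_n) (x y : L) (k : nat).

Definition rows_mx w : 'M[L]_n := \matrix_(i, j) w i 0 j.

(** If the rows are the coordinates of n forms in the basis dt_j / t_j, this is the residue of their
    wedge product: the factor 1 / (t_1 ... t_n) moves the residue from exponent -1 to exponent 0. *)
Definition rdet w : A := icoef (\det (rows_mx w)) 0.

Lemma det_upd w i r :
  \det (rows_mx (upd w i r)) = \sum_j r 0 j * cofactor (rows_mx w) i j.
Proof.
rewrite (expand_det_row _ i); apply: eq_bigr => j _; rewrite mxE upd_same.
congr (_ * _); rewrite /cofactor; congr (_ * \det _).
by apply/matrixP => a b; rewrite !mxE upd_other // eq_sym neq_lift.
Qed.

Lemma det_scale_rows (c : 'I_n -> L) w :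
  \det (rows_mx (fun i => c i *: w i)) = (\prod_i c i) * \det (rows_mx w).
Proof.
rewrite (_ : rows_mx _ = diag_mx (\row_i c i) *m rows_mx w); last first.
  by rewrite mul_diag_mx; apply/matrixP => i j; rewrite !mxE.
by rewrite det_mulmx det_diag; congr (_ * _); apply: eq_bigr => i _; rewrite mxE.
Qed.

Definition int_row (a : 'I_n -> int) : 'rV[L]_n := \row_j (a j)%:~R.

Definition euler_row y : 'rV[L]_n := \row_j eulerd j y.

Definition pow_row k x : 'rV[L]_n := \row_j (x ^+ k * eulerd j x).

Lemma det_int_rows (a : 'I_n -> 'I_n -> int) :
  \det (rows_mx (fun i => int_row (a i))) = (\det (\matrix_(i, j) a i j))%:~R.
Proof.
rewrite -(det_map_mx (intr : {rmorphism int -> L})); congr (\det _).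
by apply/matrixP => i j; rewrite !mxE.
Qed.

Lemma rdet_int_rows (a : 'I_n -> 'I_n -> int) :
  rdet (fun i => int_row (a i)) = (\det (\matrix_(i, j) a i j))%:~R.
Proof.
rewrite /rdet det_int_rows icoefMz -(monomial1 A n) icoef_mono eqxx.
by [].
Qed.

(** The indicator v of E satisfies v a = 0; multiplying by the adjugate gives v det a = 0, and v has
    the entry 1 at i0. *)
Lemma det_dependent_rows (a : 'M[int]_n) (E : 'I_n -> bool) i0 :
  E i0 -> (forall j, \sum_(i | E i) a i j = 0) -> \det a = 0.
Proof.
move=> Ei0 aE; pose v : 'rV[int]_n := \row_i (E i)%:R.
have va : v *m a = 0.
  apply/rowP => j; rewrite !mxE -[RHS](aE j) [RHS]big_mkcond /=.
  by apply: eq_bigr => i _; rewrite mxE; case: (E i); rewrite ?mul1r ?mul0r.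
have := congr1 (fun u : 'rV_n => u 0 i0) (mulmxA v a (\adj a)).
by rewrite va mul0mx mul_mx_adj mul_mx_scalar !mxE Ei0 mulr1.
Qed.

(** The row of c t^a is c t^a times the integer vector a, so the determinant is one monomial times
    det a. A nonzero constant term requires the exponents over E to add up to 0, and this very
    relation kills det a. *)
Lemma rdet_mono_rows (E : 'I_n -> bool) (c : 'I_n -> A) (a : 'I_n -> 'cV[int]_n) i0 :
  E i0 ->
  rdet (fun i => if E i then euler_row (monomial (c i) (a i))
                 else int_row (fun j => a i j 0)) = 0.
Proof.
move=> Ei0; pose b i : 'cV[int]_n := if E i then a i else 0.
pose d i := if E i then c i else 1.
rewrite /rdet (_ : (fun i => _) =
    fun i => (monomial (d i) (b i) : L) *: int_row (fun j => a i j 0)); last first.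
  apply: funext => i; rewrite /d /b; case: ifP => _; apply/rowP => j; rewrite !mxE.
    by rewrite eulerd_mono mulrzr.
  by rewrite monomial1 mul1r.
rewrite det_scale_rows det_int_rows.
have -> : \prod_i monomial (d i) (b i) = monomial (\prod_i d i) (\sum_i b i) :> L.
  elim: (index_enum _) => [|i r IHr]; first by rewrite !big_nil monomial1.
  by rewrite !big_cons IHr monomialM.
rewrite mulrzr icoefMz icoef_mono; case: eqP => [b0|_]; last by rewrite mul0rz.
rewrite (@det_dependent_rows _ E i0) ?mulr0z // => j.
have := congr1 (fun u : 'cV_n => u j 0) (esym b0).
rewrite mxE summxE => b0j; rewrite -[RHS]b0j [LHS]big_mkcond; apply: eq_bigr => i _.
by rewrite mxE /b; case: (E i); rewrite ?mxE.
Qed.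

Lemma vanishes_near0_euler_row (P : 'I_n -> L) :
  vanishes_near0 (fun y => icoef (\sum_j euler_row y 0 j * P j) 0).
Proof.
apply: (@vanishes_near0_ext _ _ _ (fun y => \sum_j icoef (eulerd j y * P j) 0)).
  by move=> y; rewrite icoef_sum; apply: eq_bigr => j _; rewrite mxE.
apply: vanishes_near0_sum => j.
exact: (vanishes_near0_eulerd _ (vanishes_near0_icoefM _ _)).
Qed.

Lemma rdet_euler_rows (E : 'I_n -> bool) (y : 'I_n -> L) (a : 'I_n -> 'I_n -> int) i0 :
  E i0 -> rdet (fun i => if E i then euler_row (y i) else int_row (a i)) = 0.
Proof.
move=> Ei0; pose W (y : 'I_n -> L) i := if E i then euler_row (y i) else int_row (a i).
(* The series of index at least k are already monomials; density frees one index at a time. *)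
suff Wk (k : nat) z : (forall i : 'I_n, (k <= i)%N -> exists c b, z i = monomial c b) ->
    rdet (W z) = 0.
  by apply: (Wk n) => i; rewrite leqNgt ltn_ord.
elim: k z => [|k IHk] z zk.
  have /choice[c /choice[b zE]] i : exists c b, z i = monomial c b by apply: zk.
  rewrite -(@rdet_mono_rows E c (fun i => if E i then b i else \col_j a i j) i0) //.
  congr rdet; apply: funext => i; rewrite /W zE; case: (E i) => //.
  by apply/rowP => j; rewrite !mxE.
have [kn|nk] := ltnP k n; last first.
  by apply: IHk => i ki; have := ltn_ord i; rewrite ltnNge (leq_trans nk).
pose k0 := Ordinal kn.
have basic_upd x : (exists c b, x = monomial c b) -> rdet (W (upd z k0 x)) = 0.
  move=> xm; apply: IHk => i ki; rewrite /upd; case: eqP => // /eqP ik.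
  apply: zk; rewrite ltn_neqAle ki andbT eq_sym.
  by apply: contraNneq ik => E'; apply/eqP/val_inj.
(* The series attached to an integer row does not occur in W and may be replaced by the zero
   monomial. *)
have [Ek|Ek] := boolP (E k0); last first.
  rewrite -(basic_upd 0); last by exists 0, 0; rewrite monomial0.
  congr rdet; apply: funext => i; rewrite /W /upd.
  by case: (i =P k0) => // ->; rewrite (negPf Ek).
have Wupd x : rdet (W (upd z k0 x)) =
    icoef (\sum_j euler_row x 0 j * cofactor (rows_mx (W z)) k0 j) 0.
  rewrite /rdet -det_upd; congr (icoef (\det (rows_mx _)) _).
  by apply: funext => i; rewrite /W /upd; case: (i =P k0) => [->|//]; rewrite Ek.
rewrite -(upd_id z k0) Wupd; move: (z k0).
apply: monomial_functional_ext => [x x'||c b].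
- rewrite -icoefB -sumrB; congr icoef; apply: eq_bigr => j _.
  by rewrite !mxE raddfB mulrBl.
- exact: vanishes_near0_euler_row.
by rewrite -Wupd basic_upd //; exists c, b.
Qed.

Lemma rdet_pow_rows_torsion_free (E : 'I_n -> bool) (x : 'I_n -> L) (k : 'I_n -> nat)
    (a : 'I_n -> 'I_n -> int) i0 :
  (forall (b : A) m, b *+ m.+1 = 0 -> b = 0) -> E i0 ->
  rdet (fun i => if E i then pow_row (k i) (x i) else int_row (a i)) = 0.
Proof.
move=> tf Ei0; set w := fun i => _.
pose m i := if E i then (k i).+1 else 1%N.
have := @rdet_euler_rows E (fun i => x i ^+ (k i).+1) a i0 Ei0.
rewrite (_ : (fun i => _) = fun i => ((m i)%:R : L) *: w i); last first.
  apply: funext => i; apply/rowP => j; rewrite /m /w; case: ifP => _; rewrite !mxE.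
    by rewrite eulerdX mulr_natl.
  by rewrite mul1r.
rewrite /rdet det_scale_rows -natr_prod mulr_natl icoefMn.
have p0 : (0 < \prod_i m i)%N by apply: prodn_gt0 => i; rewrite /m; case: ifP.
by rewrite -(prednK p0) => /tf.
Qed.

End ResidueDeterminant.

Lemma rdet_pow_rows (A : comPzRingType) n (E : 'I_n -> bool)
    (x : 'I_n -> iter_laurent A n) (k : 'I_n -> nat) (a : 'I_n -> 'I_n -> int) i0 :
  E i0 -> rdet (fun i => if E i then pow_row (k i) (x i) else int_row A (a i)) = 0.
Proof.
move=> Ei0; pose h : {rmorphism tf_cover A -> A} := @tf_cover_map A; pose H := iter_map h n.
have /choice[y yx] i : exists y, H y = x i.
  exact/iter_map_surj/tf_cover_map_surj.
pose w i := if E i then pow_row (k i) (y i) else int_row (tf_cover A) (a i).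
have := @rdet_pow_rows_torsion_free (tf_cover A) n E y k a i0 (@tf_cover_torsion_free A) Ei0.
move=> /(congr1 h); rewrite rmorph0 -icoef_iter_map -det_map_mx => <-.
congr (icoef (\det _) _); apply/matrixP => i j; rewrite !mxE.
case: ifP => _; rewrite !mxE ?rmorph_int // rmorphM rmorphXn.
by rewrite -yx eulerd_iter_map.
Qed.

(** * Exact and logarithmic rows *)

Section LogRows.
Variables (A : comPzRingType) (n : nat).
Local Notation L := (iter_laurent A n).
Implicit Types (w : 'I_n -> 'rV[L]_n) (r : 'rV[L]_n) (x y : L) (k : nat).

(** With P the cofactors of row i, this is [rdet] with r put in row i; an arbitrary P frees r from
    the other rows. *)
Definition pairing (P : 'I_n -> L) r : A := icoef (\sum_j r 0 j * P j) 0.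

Lemma pairingD P r r' : pairing P (r + r') = pairing P r + pairing P r'.
Proof.
rewrite /pairing -icoefD -big_split; congr icoef.
by apply: eq_bigr => j _; rewrite mxE mulrDl.
Qed.

Lemma pairingZ P c r : pairing P (constL n c *: r) = c * pairing P r.
Proof.
rewrite /pairing -icoef_constM mulr_sumr; congr icoef.
by apply: eq_bigr => j _; rewrite mxE mulrA.
Qed.

Lemma rdet_upd w i r : rdet (upd w i r) = pairing (cofactor (rows_mx w) i) r.
Proof. by rewrite /rdet det_upd. Qed.

Lemma rdet_row w i : rdet w = pairing (cofactor (rows_mx w) i) (w i).
Proof. by rewrite -rdet_upd upd_id. Qed.

(* Rows in the double annihilator of the rows [pow_row k x], which are the
   coordinates of the forms x^k dx in the basis dt_j / t_j. *)
Definition exact_like r :=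
  forall P, (forall k x, pairing P (pow_row k x) = 0) -> pairing P r = 0.

(** The double annihilator once the integer rows, that is the forms with constant integer
    coefficients in the dt_j / t_j, join the generators. Double annihilators are closed under
    A-linear combinations and stand in for closed spans, so that no convergence of rows has to be
    discussed. *)
Definition log_like r :=
  forall P, (forall k x, pairing P (pow_row k x) = 0) ->
    (forall a, pairing P (int_row A a) = 0) -> pairing P r = 0.

Lemma exact_like_pow k x : exact_like (pow_row k x).
Proof. by move=> P. Qed.

Lemma exact_log_like r : exact_like r -> log_like r.
Proof. by move=> rN P /rN. Qed.

Lemma log_like_int a : log_like (int_row A a).
Proof. by move=> P. Qed.

Lemma log_likeD r r' : log_like r -> log_like r' -> log_like (r + r').
Proof. by move=> rG r'G P P1 P2; rewrite pairingD rG // r'G // addr0. Qed.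

Lemma log_likeZ c r : log_like r -> log_like (constL n c *: r).
Proof. by move=> rG P P1 P2; rewrite pairingZ rG // mulr0. Qed.

(** A row enters only through its pairing with the cofactors of the others, so its defining property
    lets it be replaced by a generator. Once all rows are generators, with a power row at i0,
    [rdet_pow_rows] applies. *)
Lemma rdet_exact_row w i0 :
  exact_like (w i0) -> (forall i, i != i0 -> log_like (w i)) -> rdet w = 0.
Proof.
move=> w0 wG; rewrite (rdet_row _ i0); apply: w0 => k0 x0; rewrite -rdet_upd.
set v := upd w i0 _.
pose basic r := (exists k x, r = pow_row k x) \/ (exists a, r = int_row A a).
have vi0 : v i0 = pow_row k0 x0 by rewrite /v upd_same.
have vG i : log_like (v i).
  rewrite /v /upd; case: eqP => [_|/eqP/wG //].
  exact/exact_log_like/exact_like_pow.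
(* Rows of index at least k are generators; row i0 stays a power row throughout, because
   [rdet_pow_rows] asks for one. *)
suff vk (k : nat) u : u i0 = pow_row k0 x0 -> (forall i, log_like (u i)) ->
    (forall i : 'I_n, (k <= i)%N -> basic (u i)) -> rdet u = 0.
  by apply: (vk n) => // i; rewrite leqNgt ltn_ord.
elim: k u {v vi0 vG} => [|k IHk] u ui0 uG uk.
  have /choice[E EP] i : exists e : bool, if e then exists k x, u i = pow_row k x
      else exists a, u i = int_row A a.
    by case: (uk i isT) => [?|?]; [exists true | exists false].
  (* E may have recorded row i0 as an integer row, so i0 is put among the power rows by hand. *)
  have /choice[K /choice[X /choice[a ua]]] i : exists K X a,
      u i = if (E i) || (i == i0) then pow_row K X else int_row A a.
    have [->|_] := eqVneq i i0; first by exists k0, x0, (fun=> 0); rewrite orbT.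
    rewrite orbF; have := EP i; case: (E i).
      by move=> [K [X ->]]; exists K, X, (fun=> 0).
    by move=> [a ->]; exists 0%N, 0, a.
  rewrite -(@rdet_pow_rows A n (fun i => E i || (i == i0)) X K a i0) ?eqxx ?orbT //.
  by congr rdet; apply: funext.
have [kn|nk] := ltnP k n; last first.
  by apply: IHk => // i ki; have := ltn_ord i; rewrite ltnNge (leq_trans nk).
pose k1 := Ordinal kn.
have [k10|k10] := eqVneq k1 i0.
  apply: IHk => // i ki; have [ik|ik] := ltnP k i; first exact: uk.
  have -> : i = k1 by apply/val_inj/eqP; rewrite eqn_leq ik.
  by left; exists k0, x0; rewrite k10.
have upd_basic r : basic r -> log_like r -> rdet (upd u k1 r) = 0.
  move=> br Gr; apply: IHk => [|i|i ki].
  - by rewrite upd_other // eq_sym.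
  - by rewrite /upd; case: eqP.
  rewrite /upd; case: eqP => // /eqP ik; apply: uk.
  rewrite ltn_neqAle ki andbT eq_sym.
  by apply: contraNneq ik => E'; apply/eqP/val_inj.
rewrite (rdet_row _ k1); apply: uG => [k2 x2|a]; rewrite -rdet_upd upd_basic //.
- by left; exists k2, x2.
by right; exists a.
Qed.

(** The summands r i are removed row by row; each removal changes the value by a determinant with
    one exact row and logarithmic rows elsewhere. *)
Lemma rdet_add_exact (a r : 'I_n -> 'rV[L]_n) :
  (forall i, log_like (a i)) -> (forall i, exact_like (r i)) ->
  rdet (fun i => a i + r i) = rdet a.
Proof.
move=> aG rN; pose w (k : nat) (i : 'I_n) := if (i < k)%N then a i else a i + r i.
suff wE k : rdet (w k) = rdet (w 0%N).
  by rewrite -[LHS](wE n); congr rdet; apply: funext => i; rewrite /w ltn_ord.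
elim: k => // k <-; have [kn|nk] := ltnP k n; last first.
  congr rdet; apply: funext => i; rewrite /w.
  by rewrite !(leq_trans (ltn_ord i)) // (leq_trans nk).
pose k0 := Ordinal kn.
have -> : w k.+1 = upd (w k) k0 (a k0).
  apply: funext => i; rewrite /w /upd ltnS leq_eqVlt.
  by case: (i =P k0) => [->|/eqP/negPf ik]; rewrite ?eqxx // -[X in X || _]/(i == k0) ik.
rewrite -[w k in RHS](upd_id _ k0) !rdet_upd {3}/w ltnn pairingD.
rewrite -[X in _ = _ + X]rdet_upd (@rdet_exact_row _ k0) ?addr0 ?upd_same // => i ik.
rewrite upd_other // /w; case: ifP => // _.
exact/log_likeD/exact_log_like.
Qed.

(** The factor P is built in because the remainder of a geometric series is met multiplied by other
    series; K may depend on P and l. *)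
Definition top_nilpotent x :=
  forall P l, exists K, forall k, (K <= k)%N -> icoef (x ^+ k * P) l = 0.

(** On the factor cut out by e, y is the inverse of 1 + x, and y Dx is D log(1 + x), the sum of the
    (-1)^s x^s Dx, a series of power rows. *)
Lemma exact_like_log1p (e : A) x y : top_nilpotent x ->
  constL n e * (y * (1 + x)) = constL n e ->
  exact_like (constL n e *: (y *: euler_row x)).
Proof.
move=> xT ey P P0; rewrite pairingZ.
(* Finite geometric expansion with its exact remainder, which the pairing kills for K large by
   topological nilpotence. *)
have eyE K : constL n e * y =
    constL n e * (\sum_(s < K) (- x) ^+ s + (- x) ^+ K * y).
  elim: K => [|K ->]; first by rewrite big_ord0 add0r expr0 mul1r.
  rewrite big_ord_recr /= !mulrDr -addrA; congr (_ + _).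
  have -> : constL n e * (- x) ^+ K = (- x) ^+ K * (constL n e * (y * (1 + x))).
    by rewrite ey mulrC.
  by rewrite exprS; ring.
pose Q := \sum_j y * (eulerd j x * P j).
have [K KP] := xT Q 0.
rewrite -pairingZ scalerA (eyE K) -scalerA pairingZ scalerDl pairingD.
have -> : pairing P ((\sum_(s < K) (- x) ^+ s) *: euler_row x) = 0.
  rewrite scaler_suml; elim/big_rec: _ => [|s r _ IHr].
    by rewrite /pairing big1 ?icoef0 // => j _; rewrite mxE mul0r.
  rewrite pairingD IHr addr0 exprNn.
  have -> : ((-1) ^+ s * x ^+ s) *: euler_row x = constL n ((-1) ^+ s) *: pow_row s x.
    by apply/rowP => j; rewrite !mxE rmorphXn rmorphN rmorph1 mulrA.
  by rewrite pairingZ P0 mulr0.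
have -> : pairing P (((- x) ^+ K * y) *: euler_row x) = (-1) ^+ K * icoef (x ^+ K * Q) 0.
  rewrite -icoef_constM /pairing /Q !mulr_sumr; congr icoef; apply: eq_bigr => j _.
  by rewrite !mxE [(- x) ^+ K]exprNn rmorphXn rmorphN rmorph1; ring.
by rewrite KP // mulr0 addr0 mulr0.
Qed.

End LogRows.

(** * Logarithmic jacobians *)

(** k + 1 is the gcd of the entries, built together with its Bezout coefficients one entry at a
    time. *)
Lemma primitive_exponent n (m : 'cV[int]_n) : m != 0 ->
  exists (k : nat) (m' : 'cV[int]_n) (b : 'I_n -> int),
    m = m' *+ k.+1 /\ \sum_i b i * m' i 0 = 1.
Proof.
move=> m0.
have bez (r : seq 'I_n) : exists (b : 'I_n -> int) (g : int),
    \sum_i b i * m i 0 = g /\ forall j, j \in r -> (g %| m j 0%R)%Z.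
  elim: r => [|j r [b [g [bg gr]]]].
    by exists (fun=> 0), 0; split=> //; rewrite big1 // => i _; rewrite mul0r.
  have [u [v uv]] := Bezoutz (m j 0) g.
  exists (fun i => u * (i == j)%:R + v * b i), (gcdz (m j 0) g); split.
    rewrite -uv -bg mulr_sumr.
    under eq_bigr do rewrite mulrDl.
    rewrite big_split /=; congr (_ + _); last by apply: eq_bigr => i _; rewrite mulrA.
    rewrite (bigD1 j) //= eqxx mulr1 big1 ?addr0 // => i /negPf ->.
    by rewrite mulr0 mul0r.
  move=> i; rewrite inE => /orP[/eqP ->|/gr]; first exact: dvdz_gcdl.
  exact/dvdz_trans/dvdz_gcdr.
have [b [g [bg gm]]] := bez (enum 'I_n).
have g0 : g != 0.
  apply: contraNneq m0 => g0; apply/eqP/colP => j; rewrite mxE; apply/eqP.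
  by rewrite -dvd0z -g0 gm // mem_enum.
have gE : (absz g).-1.+1 = absz g by rewrite prednK // absz_gt0.
(* g may be negative: its sign goes into m', so that the multiplier is its absolute value. *)
pose m' : 'cV[int]_n := \col_j ((m j 0%R %/ g)%Z * sgz g).
have mE j : m j 0 = m' j 0 *+ absz g.
  rewrite mxE -mulr_natr -mulrA natz -intEsg.
  by rewrite -[LHS](divzK (gm j _)) // mem_enum.
exists (absz g).-1, m', (fun i => sgz g * b i); split.
  by apply/colP => j; rewrite gE [LHS]mE mulmxnE.
apply: (mulIf g0); rewrite mul1r -[RHS]bg mulr_suml; apply: eq_bigr => i _.
by rewrite [m i 0]mE -mulr_natr natz abszEsg; ring.
Qed.

Section LogarithmicJacobian.
Variables (A : comPzRingType) (n : nat).
Local Notation L := (iter_laurent A n).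
Variable G : 'cV[int]_n -> L.
Hypothesis G0 : G 0 = 1.
Hypothesis GD : forall a b, G (a + b) = G a * G b.

Definition dlog j a : L := G (- a) * eulerd j (G a).

Definition dlog_row (i : 'I_n) : 'rV[L]_n := \row_j dlog j (delta_mx i 0).

Lemma GV a : G a * G (- a) = 1. Proof. by rewrite -GD subrr. Qed.

Lemma dlogD j a b : dlog j (a + b) = dlog j a + dlog j b.
Proof.
rewrite /dlog opprD !GD eulerdM.
transitivity ((G b * G (- b)) * (G (- a) * eulerd j (G a))
  + (G a * G (- a)) * (G (- b) * eulerd j (G b))); first by ring.
by rewrite !GV !mul1r.
Qed.

Lemma dlog_is_zmod_morphism j : zmod_morphism (dlog j).
Proof. by move=> a b; apply: (addIr (dlog j b)); rewrite -dlogD !subrK. Qed.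

HB.instance Definition _ j := GRing.isZmodMorphism.Build 'cV[int]_n L (dlog j)
  (dlog_is_zmod_morphism j).

Lemma dlogE j a : dlog j a = \sum_i dlog_row i 0 j *~ a i 0.
Proof.
have mzE (M : 'cV[int]_n) (z : int) k : (M *~ z) k 0 = M k 0 *~ z.
  by case: z => z; rewrite /intmul ?mxE mulmxnE.
have {1}-> : a = \sum_i delta_mx i 0 *~ a i 0.
  apply/colP => k; rewrite summxE (bigD1 k) //= mzE mxE !eqxx mulrzz mul1r.
  rewrite big1 ?addr0 // => i ik; rewrite mzE mxE.
  by rewrite eq_sym (negPf ik) mul0rz.
by rewrite raddf_sum; apply: eq_bigr => i _; rewrite raddfMz mxE.
Qed.

Lemma eulerd_G j a : eulerd j (G a) = G a * dlog j a.
Proof. by rewrite mulrA GV mul1r. Qed.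

Lemma GMn a k : G (a *+ k) = G a ^+ k.
Proof. by elim: k => [|k IHk]; rewrite ?mulr0n ?expr0 // mulrS exprS GD IHk. Qed.

Lemma residue_dlog_eq0 m : (forall i, log_like (dlog_row i)) -> m != 0 ->
  icoef (G m * \det (rows_mx dlog_row)) 0 = 0.
Proof.
move=> WG m0; have [k [m' [b [mE bm]]]] := primitive_exponent m0.
set T := icoef _ 0.
suff Tm i : T *~ m' i 0 = 0.
  rewrite -[T]mulr1z -bm mulrz_sumr big1 // => i _.
  by rewrite mulrC mulrzA Tm mul0rz.
(* The new row i is G m times a combination of the rows of W; since W adj(W) is scalar, only the
   term of row i, with coefficient m'_i, contributes to the determinant. *)
have <- : rdet (upd dlog_row i (pow_row k (G m'))) = 0.
  apply: (@rdet_exact_row _ _ _ i); first by rewrite upd_same; apply: exact_like_pow.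
  by move=> i' ii; rewrite upd_other.
rewrite /T /rdet -icoefMz det_upd; congr (icoef _ 0).
under eq_bigr => j _ do rewrite mxE eulerd_G mulrA -exprSr -GMn -mE dlogE -mulrA mulr_suml.
rewrite -mulr_sumr exchange_big /= -mulrzAr; congr (_ * _).
under eq_bigr => s _.
  under eq_bigr => j _ do rewrite mulrzAl.
  rewrite -mulrz_suml.
  have -> : \sum_j dlog_row s 0 j * cofactor (rows_mx dlog_row) i j =
      (rows_mx dlog_row *m \adj (rows_mx dlog_row)) s i.
    by rewrite [RHS]mxE; apply: eq_bigr => j _; rewrite !mxE.
  rewrite mul_mx_adj mxE.
over.
rewrite (bigD1 i) //= eqxx mulr1n big1 ?addr0 // => s /negPf ->.
by rewrite mulr0n mul0rz.
Qed.

Lemma residue_dlog_det (e : A) (l : 'I_n -> 'I_n -> int) : e * e = e ->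
  (forall i, exact_like (constL n e *: (dlog_row i - int_row A (l i)))) ->
  e * rdet dlog_row = e * (\det (\matrix_(i, j) l i j))%:~R.
Proof.
move=> ee rN; rewrite -(rdet_int_rows A l).
rewrite -(rdet_add_exact (fun i => log_like_int (l i)) rN).
rewrite /rdet -!icoef_constM; congr (icoef _ 0).
rewrite /determinant !mulr_sumr; apply: eq_bigr => s _.
rewrite !(mulrCA (constL n e)); congr (_ * _).
have EE : constL n e * constL n e = constL n e by rewrite -rmorphM ee.
have EX k j : constL n e * rows_mx (fun i => int_row A (l i) +
      constL n e *: (dlog_row i - int_row A (l i))) k j =
    constL n e * rows_mx dlog_row k j.
  by rewrite !mxE mulrDr mulrA EE -mulrDr; congr (_ * _); ring.
elim: (index_enum _) => [|i r IHr]; first by rewrite !big_nil.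
by rewrite !big_cons mulrA -EX -mulrA mulrCA IHr mulrCA.
Qed.

End LogarithmicJacobian.

(** * Prime ideals, nilpotents and idempotents *)

Definition in_prime (R : comPzRingType) (p : Spec R) (x : R) : Prop := prime_set p x.
Coercion in_prime : Spec >-> Funclass.

Section PrimeTheory.
Variables (R : comPzRingType) (p : Spec R).

Lemma prime0 : p 0. Proof. by have [] := prime_setP p. Qed.

Lemma primeD x y : p x -> p y -> p (x + y).
Proof. by have [_ + _ _ _] := prime_setP p; apply. Qed.

Lemma primeM a x : p x -> p (a * x).
Proof. by have [_ _ + _ _] := prime_setP p; apply. Qed.

Lemma primeMr a x : p x -> p (x * a).
Proof. by rewrite mulrC; apply: primeM. Qed.

Lemma prime1 : ~ p 1. Proof. by have [] := prime_setP p. Qed.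

Lemma prime_or x y : p (x * y) -> p x \/ p y.
Proof. by have [_ _ _ _] := prime_setP p; apply. Qed.

Lemma primeN x : p x -> p (- x).
Proof. by rewrite -mulN1r; apply: primeM. Qed.

Lemma primeDr x y : p (x + y) -> p y -> p x.
Proof. by move=> pxy py; rewrite -(addrK y x); apply/primeD/primeN. Qed.

Lemma primeX x k : p (x ^+ k) -> p x.
Proof.
elim: k => [/prime1 //|k IHk]; rewrite exprS => /prime_or[//|/IHk //].
Qed.

Lemma prime_sum (I : Type) (r : seq I) (P : pred I) (F : I -> R) :
  (forall i, P i -> p (F i)) -> p (\sum_(i <- r | P i) F i).
Proof. by move=> pF; elim/big_ind: _ => //; [exact: prime0 | exact: primeD]. Qed.

End PrimeTheory.

(** If x is not nilpotent, Zorn's lemma gives an ideal maximal among those containing no power of x,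
    and it is prime. *)
Lemma nilpotent_prime (R : comPzRingType) (x : R) :
  nilpotent_elt x <-> forall p : Spec R, p x.
Proof.
split=> [[k xk] p|px]; first by apply: (@primeX _ p _ k); rewrite xk; apply: prime0.
apply: contrapT => nx.
(* Membership of 0 is left out so that the union of the empty chain satisfies P; it is recovered
   below from maximality. *)
pose P (I : set R) := [/\ forall a b, I a -> I b -> I (a + b),
  forall a b, I b -> I (a * b) & forall k, ~ I (x ^+ k)].
have [F FP totF|I [[ID IM Ix] Imax]] := @Zorn_bigcup R P.
  split=> [a b [X FX Xa] [Y FY Yb]|a b [X FX Xb]|k [X FX Xk]].
  - have [XY|YX] := totF _ _ FX FY.
      by exists Y => //; have [+ _ _] := FP _ FY; apply => //; apply: XY.
    by exists X => //; have [+ _ _] := FP _ FX; apply => //; apply: YX.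
  - by exists X => //; have [_ + _] := FP _ FX; apply.
  by have [_ _ /(_ k)] := FP _ FX.
have I0 : I 0.
  apply: contrapT => nI0; apply: (Imax [set 0]%classic).
    split=> [a Ia|/(_ 0 erefl) //]; exfalso; apply: nI0.
    by rewrite -(mul0r a); apply: IM.
  split=> [a b -> ->|a b ->|k xk]; rewrite /= ?addr0 ?mulr0 //.
  by apply: nx; exists k.
have ext a : ~ I a -> exists k u r, I u /\ x ^+ k = u + r * a.
  move=> nIa; apply: contrapT => nk.
  apply: (Imax [set y | exists u r, I u /\ y = u + r * a]%classic).
    split=> [y Iy|/(_ a) sub]; first by exists y, 0; rewrite mul0r addr0.
    by apply/nIa/sub; exists 0, 1; rewrite mul1r add0r.
  split=> [_ _ [u [r [Iu ->]]] [v [s [Iv ->]]]|b _ [u [r [Iu ->]]]|k [u [r [Iu xk]]]].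
  - by exists (u + v), (r + s); split; [exact: ID | ring].
  - by exists (b * u), (b * r); split; [exact: IM | ring].
  by apply: nk; exists k, u, r.
have Iprime : prime_ideal I.
  split=> //; first by move=> I1; apply: (Ix 0%N).
  move=> a b Iab; apply: contrapT => /not_orP[/ext[k [u [r [Iu xk]]]] /ext[m [v [s [Iv xm]]]]].
  apply: (Ix (k + m)%N); rewrite exprD xk xm.
  have -> : (u + r * a) * (v + s * b) = (v + s * b) * u + ((r * a) * v + (r * s) * (a * b)).
    by ring.
  by apply: (ID); [exact: IM | apply: (ID); exact: IM].
by have := px (MkSpec Iprime); rewrite -[x]expr1; apply: Ix.
Qed.

Lemma not_nilpotent_prime (R : comPzRingType) (x : R) :
  ~ nilpotent_elt x -> exists p : Spec R, ~ p x.
Proof. by move=> nx; apply/existsNP => px; apply/nx/nilpotent_prime. Qed.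

Section Nilpotent.
Variable R : comPzRingType.
Implicit Types x y : R.

Lemma nilpotent0 : nilpotent_elt (0 : R). Proof. by exists 1%N; rewrite expr1. Qed.

Lemma nilpotentD x y : nilpotent_elt x -> nilpotent_elt y -> nilpotent_elt (x + y).
Proof.
by rewrite !nilpotent_prime => px py p; apply: primeD.
Qed.

Lemma nilpotentM a x : nilpotent_elt x -> nilpotent_elt (a * x).
Proof. by rewrite !nilpotent_prime => px p; apply: primeM. Qed.

Lemma nilpotent_sum (I : Type) (r : seq I) (P : pred I) (F : I -> R) :
  (forall i, P i -> nilpotent_elt (F i)) -> nilpotent_elt (\sum_(i <- r | P i) F i).
Proof.
by move=> nF; apply/nilpotent_prime => p; apply: prime_sum => i /nF/nilpotent_prime.
Qed.

Lemma nilpotent_idem x : nilpotent_elt x -> x * x = x -> x = 0.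
Proof.
move=> [k xk] xx; suff xE m : x ^+ m.+1 = x by rewrite -(xE k) exprS xk mulr0.
by elim: m => [|m IHm]; rewrite ?expr1 // exprS IHm.
Qed.

End Nilpotent.

Section LeadingIndex.
Variables (R : comPzRingType) (p : Spec R).
Implicit Types (f g : laurent R) (v w : int).

(** The order of f modulo p, as a series over the domain R / p. *)
Definition lead_index f v := ~ p (f v) /\ forall i, i < v -> p (f i).

Lemma lead_index_exists f i : ~ p (f i) -> exists2 v, v <= i & lead_index f v.
Proof.
move=> fi; have [N fN] := laurent_bound f.
have Ni : N <= i by rewrite leNgt; apply/negP => /fN fi0; apply: fi; rewrite fi0; apply: prime0.
pose Q k := `[< ~ p (f (N + k%:Z)) >].
have exQ : exists k, Q k.
  by exists (absz (i - N)%R); apply/asboolP; rewrite (_ : _ + _ = i) //; lia.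
have /asboolP Qm := ex_minnP exQ.
case: (ex_minnP exQ) => m /asboolP pm mmin; exists (N + m%:Z).
  have : (m <= absz (i - N)%R)%N.
    by apply: mmin; apply/asboolP; rewrite (_ : _ + _ = i) //; lia.
  by lia.
split=> // j jm; have [jN|Nj] := ltP j N; first by rewrite fN //; apply: prime0.
apply: contrapT => pj.
have : (m <= absz (j - N)%R)%N.
  by apply: mmin; apply/asboolP; rewrite (_ : _ + _ = j) //; lia.
by lia.
Qed.

Lemma lead_indexM f g v w :
  lead_index f v -> lead_index g w -> lead_index (f * g) (v + w).
Proof.
move=> [fv fi] [gw gi]; have [[N fN] [M gM]] := (laurent_bound f, laurent_bound g).
have Nv : N <= v by rewrite leNgt; apply/negP => /fN f0; apply: fv; rewrite f0; apply: prime0.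
(* The summand with v - N makes the range long enough to contain the index v. *)
have coefE k : (f * g) k = \sum_(i < (absz (k - N - M)%R + absz (v - N)%R).+1)
    f (N + i%:Z) * g (k - N - i%:Z).
  by apply: (@lcoefM_fin _ _ _ _ N M) => //; lia.
split=> [|k kvw]; rewrite coefE; last first.
  apply: prime_sum => i _; have [iv|vi] := ltP (N + i%:Z) v; first exact/primeMr/fi.
  by apply/primeM/gi; lia.
have im : (absz (v - N)%R < (absz (v + w - N - M)%R + absz (v - N)%R).+1)%N by lia.
rewrite (bigD1 (Ordinal im)) //= => /primeDr H.
have /prime_or[] : p (f (N + (absz (v - N)%R)%:Z) * g (v + w - N - (absz (v - N)%R)%:Z)).
  apply: H; apply: prime_sum => i /eqP ii.
  have [iv|vi] := ltP (N + i%:Z) v; first exact/primeMr/fi.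
  have [E|ne] := eqVneq (N + i%:Z) v.
    by case: ii; apply/val_inj => /=; lia.
  by apply/primeM/gi; move: ne => /eqP ne; lia.
- by rewrite (_ : _ + _ = v) //; lia.
by rewrite (_ : v + w - N - _ = w) //; lia.
Qed.

Lemma lead_index_unique f v w : lead_index f v -> lead_index f w -> v = w.
Proof.
move=> [fv fi] [fw fj]; apply/eqP; rewrite eq_le !leNgt.
by apply/andP; split; apply/negP; [move=> /fi/fw|move=> /fj/fv].
Qed.

Lemma lead_index1 : lead_index 1 0.
Proof.
split=> [|i i0]; first exact: prime1.
by rewrite /= lt_eqF //; apply: prime0.
Qed.

Lemma lead_indexX f v k : lead_index f v -> lead_index (f ^+ k) (v *+ k).
Proof.
move=> fv; elim: k => [|k IHk]; first exact: lead_index1.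
by rewrite exprS mulrS; apply: lead_indexM.
Qed.

Lemma lead_index0 v : ~ lead_index 0 v.
Proof. by move=> [] []; apply: prime0. Qed.

End LeadingIndex.

Section LaurentNilpotent.
Variable R : comPzRingType.
Implicit Types f h : laurent R.

(** Modulo any prime the orders of f and h add up to 0; a product f_i h_j outside the prime would
    force this sum to be at most i + j. *)
Lemma laurent_unit_nilpotent f h i j : f * h = 1 -> i + j < 0 ->
  nilpotent_elt (f i * h j).
Proof.
move=> fh ij; apply/nilpotent_prime => p; apply: contrapT => fihj.
have [v vi fv] : exists2 v, v <= i & lead_index p f v.
  by apply: lead_index_exists => fi; apply/fihj/primeMr.
have [w wj hw] : exists2 w, w <= j & lead_index p h w.
  by apply: lead_index_exists => hj; apply/fihj/primeM.
have := lead_indexM fv hw; rewrite fh => /lead_index_unique/(_ (lead_index1 p)).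
by lia.
Qed.

Lemma laurent_nilpotent_coef f i : nilpotent_elt f -> nilpotent_elt (f i).
Proof.
move=> [k fk]; apply/nilpotent_prime => p; apply: contrapT => /lead_index_exists[v _].
by move=> fv; have := lead_indexX k fv; rewrite fk; apply: lead_index0.
Qed.

Lemma lmonoX c i k : lmono (c : R) i ^+ k = lmono (c ^+ k) (i *+ k).
Proof. by elim: k => // k IHk; rewrite exprS IHk lmonoM -exprS mulrS. Qed.

Lemma lmono_nilpotent c i : nilpotent_elt c -> nilpotent_elt (lmono (c : R) i).
Proof. by move=> [k ck]; exists k; rewrite lmonoX ck lmono0. Qed.

End LaurentNilpotent.

Lemma nilpotent_icoef (A : comPzRingType) n (f : iter_laurent A n) l :
  nilpotent_elt f -> nilpotent_elt (icoef f l).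
Proof.
elim: n f l => [//|n IHn] f l fn.
exact: IHn (@laurent_nilpotent_coef (iter_laurent_ring A n) f _ fn).
Qed.

Section Partition.
Variable R : comPzRingType.

Definition idem_partition (I : finType) (e : I -> R) :=
  (forall i j, e i * e j = if i == j then e i else 0) /\ \sum_i e i = 1.

Lemma comaximal2 (a b : R) p q : exists u v, (a + b) ^+ (p + q) = a ^+ p * u + b ^+ q * v.
Proof.
have [m] := ubnP (p + q)%N; elim: m p q => // m IHm [|p] [|q] pq.
- by exists 1, 0; rewrite !expr0; ring.
- by exists ((a + b) ^+ q.+1), 0; rewrite expr0 add0n; ring.
- by exists 0, ((a + b) ^+ p.+1); rewrite expr0 addn0; ring.
have [u [v E1]] := IHm p q.+1 ltac:(lia); have [u' [v' E2]] := IHm p.+1 q ltac:(lia).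
(* One factor a + b is split off: a multiplies the first expansion, b the second. *)
exists (u + b * u'), (a * v + v').
rewrite addSn -addnS in E2; rewrite addSn exprS mulrDl {1}E1 E2 !exprS; ring.
Qed.

Lemma comaximal_powers (I : finType) (e : I -> R) m : \sum_i e i = 1 ->
  exists r, \sum_i r i * e i ^+ m = 1.
Proof.
have [k [r E]] : exists k r, (\sum_i e i) ^+ k = \sum_i r i * e i ^+ m.
  have : uniq (index_enum I) := index_enum_uniq I.
  elim: (index_enum I) => [|i s IHs] /=.
    by exists 1%N, (fun=> 0); rewrite !big_nil expr1.
  move=> /andP[is_ /IHs[k [r E]]].
  have [u [v uv]] := comaximal2 (e i) (\sum_(j <- s) e j) m k.
  exists (m + k)%N, (fun j => if j == i then u else v * r j).
  rewrite !big_cons uv eqxx E [in LHS]mulrC; congr (_ + _); rewrite mulrC mulr_sumr.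
  rewrite big_seq [RHS]big_seq; apply: eq_bigr => j js.
  by rewrite ifF ?mulrA //; apply: contraNF is_ => /eqP <-.
by move=> e1; exists r; rewrite -E e1 expr1n.
Qed.

(* Orthogonality modulo nilpotents suffices: the idempotents are
   s_i e_i = r_i e_i^m, with m such that (e_i e_j)^m = 0 for i != j. *)
Lemma lift_idem_partition (I : finType) (e : I -> R) :
  \sum_i e i = 1 -> (forall i j, i != j -> nilpotent_elt (e i * e j)) ->
  exists s, idem_partition (fun i => s i * e i).
Proof.
move=> e1 en.
have /choice[m mP] (ij : I * I) : exists k, ij.1 != ij.2 -> (e ij.1 * e ij.2) ^+ k = 0.
  by have [->|/en[k ek]] := eqVneq ij.1 ij.2; [exists 0%N | exists k].
pose M := (\sum_ij m ij).+1.
have eM i j : i != j -> e i ^+ M * e j ^+ M = 0.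
  move=> ij; rewrite -exprMn /M (bigD1 (i, j)) //= -addnS exprD (mP (i, j)) //.
  by rewrite mul0r.
have [r rE] := comaximal_powers M e1.
exists (fun i => r i * e i ^+ M.-1).
have sE i : r i * e i ^+ M.-1 * e i = r i * e i ^+ M by rewrite -mulrA -exprSr.
have sij i j : i != j -> (r i * e i ^+ M) * (r j * e j ^+ M) = 0.
  by move=> /eM ij; rewrite mulrACA ij mulr0.
split=> [i j|]; last by rewrite -[RHS]rE; apply: eq_bigr => i _; rewrite sE.
rewrite !sE; case: (eqVneq i j) => [<-|/sij //].
rewrite -[RHS]mulr1 -[in RHS]rE (bigD1 i) //= mulrDr mulr_sumr big1 ?addr0 //.
by move=> k ki; apply: sij; rewrite eq_sym.
Qed.

End Partition.

Section TopNilpotent.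
Variables (A : comPzRingType) (n : nat).
Local Notation L := (iter_laurent A n).
Implicit Types (x y : L).

(** In the binomial expansion the terms with x-exponent at least M vanish; for each of the finitely
    many smaller exponents r, y^s kills x^r P once s reaches K r. *)
Lemma top_nilpotentD x y : top_nilpotent y ->
  (forall P l, exists M, forall r s, (M <= r)%N -> icoef (x ^+ r * y ^+ s * P) l = 0) ->
  top_nilpotent (x + y).
Proof.
move=> yT xT P l; have [M MP] := xT P l.
have /choice[K KP] r := yT (x ^+ r * P) l.
exists (M + \sum_(r < M) K r)%N => k Mk.
rewrite exprDn mulr_suml icoef_sum big1 // => i _.
rewrite mulrnAl icoefMn; have [Mr|rM] := leqP M (k - i).
  by rewrite MP // mul0rn.
rewrite -mulrA mulrCA KP ?mul0rn //.
have : (K (k - i)%N <= \sum_(r < M) K r)%N.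
  by rewrite (bigD1 (Ordinal rM)) //= leq_addr.
have := ltn_ord i; lia.
Qed.

Lemma top_nilpotentD_nilpotent x y :
  nilpotent_elt x -> top_nilpotent y -> top_nilpotent (x + y).
Proof.
move=> [k xk] yT; apply: top_nilpotentD => // P l; exists k => r s kr.
by rewrite -(subnK kr) exprD xk mulr0 !mul0r icoef0.
Qed.

End TopNilpotent.

Lemma top_nilpotent0 (A : comPzRingType) n : top_nilpotent (0 : iter_laurent A n).
Proof. by move=> P l; exists 1%N => [[//|k]] _; rewrite expr0n mul0r icoef0. Qed.

Section LowerBounds.
Variable R : comPzRingType.
Implicit Types f g : laurent R.

Definition lower_bound f (N : int) := forall k, k < N -> f k = 0.

Lemma lower_boundM f g N M :
  lower_bound f N -> lower_bound g M -> lower_bound (f * g) (N + M).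
Proof. by move=> fN gM; apply: lconv_bound. Qed.

Lemma lower_bound1 : lower_bound 1 0.
Proof. by move=> k k0; rewrite /= lt_eqF. Qed.

Lemma lower_boundX f N r : lower_bound f N -> lower_bound (f ^+ r) (N *+ r).
Proof.
move=> fN; elim: r => [|r IHr]; first exact: lower_bound1.
by rewrite exprS mulrS; apply: lower_boundM.
Qed.

Definition truncation (Q : pred int) f : laurent R :=
  Laurent (introT (bounded_belowP (fun k => if Q k then f k else 0))
    (let: ex_intro N fN := laurent_bound f in
     ex_intro _ N (fun k kN =>
       match Q k as b return (if b then f k else 0) = 0 with
       | true => fN k kN
       | false => erefl
       end))).

Lemma truncationE Q f k : truncation Q f k = if Q k then f k else 0.
Proof. by []. Qed.

Lemma truncation_split f i :
  f = truncation (fun k => k < i) f + lmono (f i) i + truncation (fun k => i < k) f.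
Proof.
apply: laurentP => k; rewrite !lcoefD !truncationE /=.
by have [ki|ki|->] := ltgtP k i; rewrite ?add0r ?addr0.
Qed.

Lemma nilpotent_truncation f i : (forall k, k < i -> nilpotent_elt (f k)) ->
  nilpotent_elt (truncation (fun k => k < i) f).
Proof.
move=> fn; have [N fN] := laurent_bound f.
have -> : truncation (fun k => k < i) f =
    \sum_(j < absz (i - N)%R | N + j%:Z < i) lmono (f (N + j%:Z)) (N + j%:Z).
  apply: laurentP => k; rewrite truncationE lcoef_sum /=.
  have [ki|ik] := ltP k i; last first.
    by rewrite big1 // => j ji; rewrite gt_eqF // (lt_le_trans ji).
  have [kN|Nk] := ltP k N.
    by rewrite fN // big1 // => j _; rewrite lt_eqF // (lt_le_trans kN) //; lia.
  have km : (absz (k - N)%R < absz (i - N)%R)%N by lia.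
  rewrite (bigD1 (Ordinal km)) /=; last by lia.
  rewrite ifT; last by apply/eqP; lia.
  rewrite big1 ?addr0 => [|j /andP[_ /eqP jk]]; first by congr (f _); lia.
  by case: eqP => // E; case: jk; apply/val_inj => /=; lia.
by apply: nilpotent_sum => j ji; apply/lmono_nilpotent/fn.
Qed.

End LowerBounds.

Lemma constLS (A : comPzRingType) n (a : A) :
  constL n.+1 a = lmono (constL n a : iter_laurent_ring A n) 0.
Proof.
rewrite /constL /= mxE (_ : row' ord_max 0 = 0) //.
by apply/colP => j; rewrite !mxE.
Qed.

Lemma icoef_consE (A : comPzRingType) n (f : iter_laurent A n.+1) l :
  icoef f l = icoef ((f : laurent (iter_laurent_ring A n)) (l ord_max 0) : iter_laurent A n)
    (row' ord_max l).
Proof. by []. Qed.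

(** Split off the term of outer exponent 0: what remains has order at least 1, so its r-th power has
    order at least r, whatever power of the split-off term multiplies it. *)
Lemma top_nilpotent_cons (A : comPzRingType) n (z : iter_laurent A n.+1) :
  let z' : laurent (iter_laurent_ring A n) := z in
  lower_bound z' 0 -> top_nilpotent (z' 0 : iter_laurent A n) -> top_nilpotent z.
Proof.
pose R := iter_laurent_ring A n.
move=> z' zb zT; pose y : laurent R := lmono (z' 0) 0; pose x : laurent R := z' - y.
have zxy : z = (x + y : laurent R) :> iter_laurent A n.+1 by rewrite /x subrK.
rewrite zxy; apply: top_nilpotentD => P l.
  have [K KP] := zT ((P : laurent R) (l ord_max 0)) (row' ord_max l).
  exists K => k /KP H.
  rewrite icoef_consE -[X in icoef X]/(((y ^+ k : laurent R) * (P : laurent R)) (l ord_max 0)).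
  by rewrite lmonoX mul0rn lcoefM_lmono subr0.
have [N PN] := laurent_bound (P : laurent R).
exists (absz (l ord_max 0 - N)%R).+1 => r s Mr.
have xb : lower_bound x 1.
  move=> k k1; rewrite -[LHS]/(z' k - y k) /=; case: eqP => [->|k0].
    by rewrite subrr.
  by rewrite subr0 zb //; lia.
have yb : lower_bound y 0 by move=> k k0; rewrite /= lt_eqF.
have := lower_boundM (lower_boundM (@lower_boundX _ _ _ r xb) (@lower_boundX _ _ _ s yb)) PN.
rewrite icoef_consE => H; rewrite -[RHS](@icoef0 A n (row' ord_max l)).
by congr icoef; apply: H; rewrite mul0rn natz; lia.
Qed.

(** * Idempotent Laurent series are constant *)

Section Idempotents.

(** D is a nilpotent series plus one of positive order, hence topologically nilpotent, while all its
    positive powers equal D. *)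
Lemma laurent_idem_nilpotent (R : comPzRingType) (D : laurent R) :
  D * D = D -> (forall i, nilpotent_elt (D i)) -> D = 0.
Proof.
move=> DD Dn; pose y := truncation (fun k => k < 1) D.
pose z := truncation (fun k => ~~ (k < 1)) D.
have DE : D = y + z.
  apply: laurentP => k; rewrite lcoefD !truncationE.
  by case: (k < 1); rewrite ?addr0 ?add0r.
have yn : nilpotent_elt y by apply: nilpotent_truncation.
have zT : @top_nilpotent R 1 z.
  apply: top_nilpotent_cons => [k k0|].
    by rewrite truncationE ifF // (lt_trans k0).
  rewrite truncationE /=; exact: (@top_nilpotent0 R 0).
have DT : @top_nilpotent R 1 D by rewrite DE; apply: top_nilpotentD_nilpotent.
apply: (@icoef_ext R 1) => l; rewrite icoef0.
have [K KP] := DT 1 l; have := KP K.+1 (leqnSn _); rewrite mulr1 => H; rewrite -[RHS]H.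
congr icoef; elim: K {KP H} => [|K IHK]; first by rewrite expr1.
by rewrite exprS -IHK; apply/esym.
Qed.

(** Modulo each prime E or 1 - E vanishes, so E_0 is idempotent up to a nilpotent and the other E_i
    are nilpotent. With e an idempotent lifting E_0, both E (1 - e) and (1 - E) e are idempotents
    with nilpotent coefficients, hence 0. *)
Lemma laurent_idem (R : comPzRingType) (E : laurent R) : E * E = E ->
  exists2 e, e * e = e & E = lmono e 0.
Proof.
move=> EE; pose F := 1 - E.
have FF : F * F = F by rewrite /F mulrBl !mul1r mulrBr EE mulr1 subrr subr0.
have EF : E * F = 0 by rewrite /F mulrBr EE mulr1 subrr.
have lead0 (p : Spec R) (D : laurent R) v : D * D = D -> lead_index p D v -> v = 0.
  by move=> DD Dv; have := lead_indexM Dv Dv; rewrite DD => /lead_index_unique/(_ Dv); lia.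
have dich (p : Spec R) : (forall i, p (E i)) \/ (forall i, p (F i)).
  apply: contrapT => /not_orP[/existsNP[i Ei] /existsNP[j Fj]].
  have [v _ Ev] := lead_index_exists Ei; have [w _ Fw] := lead_index_exists Fj.
  by have := lead_indexM Ev Fw; rewrite EF; apply: lead_index0.
have En i : i != 0 -> nilpotent_elt (E i).
  move=> i0; apply/nilpotent_prime => p; have [//|/(_ i)] := dich p.
  rewrite -[F i]/((1 : laurent R) i - E i) /= (negPf i0) sub0r => /primeN.
  by rewrite opprK.
have E0n : nilpotent_elt (E 0 * (1 - E 0)).
  apply/nilpotent_prime => p; have [/(_ 0)|/(_ 0)] := dich p.
    exact: primeMr.
  by rewrite -[F 0]/((1 : laurent R) 0 - E 0) /= => /primeM; apply.
pose a (b : bool) := if b then E 0 else 1 - E 0.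
have [|b b'|s [sM]] := @lift_idem_partition R bool a.
- by rewrite big_bool /= addrC subrK.
- by case: b b' => [] [] //= _; rewrite ?(mulrC (1 - _)).
rewrite big_bool /= => s1; set e := s true * E 0 in s1.
have s1' : s false * (1 - E 0) = 1 - e by apply: (addrI e); rewrite s1 [RHS]addrC subrK.
have ee : e * e = e := sM true true.
have [EeE eE] : E * lmono (1 - e) 0 = 0 /\ (1 - E) * lmono e 0 = 0.
  have oo : (1 - e) * (1 - e) = 1 - e by rewrite mulrBl !mul1r mulrBr ee mulr1 subrr subr0.
  split; apply: laurent_idem_nilpotent => [|i].
  - by rewrite mulrACA EE lmonoM oo addr0.
  - rewrite mulrC lcoefM_lmono subr0; have [->|i0] := eqVneq i 0.
      by rewrite -s1' -mulrA; apply: nilpotentM; rewrite mulrC.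
    exact/nilpotentM/En.
  - by rewrite mulrACA FF lmonoM ee addr0.
  rewrite mulrC lcoefM_lmono subr0 -[(1 - E) i]/((1 : laurent R) i - E i) /=.
  have [->|i0] := eqVneq i 0.
    by rewrite /e -mulrA; apply: nilpotentM.
  by rewrite sub0r mulrN -mulNr; apply/nilpotentM/En.
exists e => //; have : E * lmono 1 0 = E by rewrite [lmono _ _]/(1 : laurent R) mulr1.
move/eqP: eE; rewrite mulrBl -[X in X - _](mul1r) subr_eq0 => /eqP E1.
move=> <-; rewrite -(subrK e 1) lmonoD mulrDr EeE add0r -E1.
by rewrite -[X in X * _]/(1 : laurent R) !mul1r.
Qed.

Lemma iter_laurent_idem (A : comPzRingType) n (E : iter_laurent A n) : E * E = E ->
  exists2 e, e * e = e & E = constL n e.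
Proof.
elim: n E => [|n IHn] E EE; first by exists E.
have [e /IHn[a aa ->] ->] := @laurent_idem (iter_laurent_ring A n) E EE.
by exists a; rewrite ?constLS.
Qed.

End Idempotents.

(** * Structure of invertible series *)

Section Locally.
Variable A : comPzRingType.

(** Validity on the factors of some finite decomposition of A. Q receives the idempotent of the
    factor, so that statements about the factor are written inside A, as identities multiplied by
    e. *)
Definition locally (Q : A -> Prop) :=
  exists (I : finType) (e : I -> A), idem_partition e /\ forall i, Q (e i).

Lemma locally1 (Q : A -> Prop) : Q 1 -> locally Q.
Proof.
move=> Q1; exists unit, (fun=> 1); split=> //; split=> [[] []|]; first by rewrite mul1r.
by rewrite (bigD1 tt) //= big1 ?addr0 // => -[].
Qed.

(** Each member e_i of a partition is refined by a partition a_(i j) of its own; the new idempotents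
    are the products e_i a_(i j). *)
Lemma locally_bind (Q Q'' : A -> Prop) (Q' : A -> A -> Prop) : locally Q ->
  (forall e, e * e = e -> Q e -> locally (Q' e)) ->
  (forall e a, e * e = e -> a * a = a -> Q e -> Q' e a -> Q'' (e * a)) -> locally Q''.
Proof.
move=> [I [e [[eM e1] eQ]]] QQ' QQ''.
have ee i : e i * e i = e i by rewrite eM eqxx.
have exS (i : I) : exists S : {J : finType & J -> A},
    idem_partition (projT2 S) /\ forall j, Q' (e i) (projT2 S j).
  by have [J [a aP]] := QQ' _ (ee i) (eQ i); exists (existT _ J a).
have [S SP] := choice exS.
pose J i := projT1 (S i); pose a i : J i -> A := projT2 (S i).
have aM i : idem_partition (a i) by have [] := SP i.
exists {i : I & J i}, (fun u => e (tag u) * a (tag u) (tagged u)); split; last first.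
  move=> [i j] /=; apply: QQ'' => //; last by have [_] := SP i; apply.
  by have [-> _] := aM i; rewrite eqxx.
split=> [[i j] [i' j'] /=|].
  rewrite mulrACA eM; case: eqP j' => [<- j'|ii' j'].
    by rewrite eq_Tagged /= (aM i).1; case: eqP => //; rewrite mulr0.
  by rewrite mul0r; case: eqP => // /(congr1 tag).
rewrite -(@sig_big_dep _ _ _ _ _ xpredT (fun _ => xpredT) (fun i j => e i * a i j)) /=.
rewrite -[RHS]e1; apply: eq_bigr => i _.
by rewrite -mulr_sumr (aM i).2 mulr1.
Qed.

Lemma locally_all n (Q : 'I_n -> A -> Prop) :
  (forall i e a, a * a = a -> Q i e -> Q i (e * a)) ->
  (forall i, locally (Q i)) -> locally (fun e => forall i, Q i e).
Proof.
move=> QM Ql; pose Qk k e := forall i : 'I_n, (i < k)%N -> Q i e.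
suff Hk k : locally (Qk k).
  by have [I [e [eP eQ]]] := Hk n; exists I, e; split=> // i j; apply: eQ.
elim: k => [|k IHk]; first exact: locally1.
have [kn|nk] := ltnP k n; last first.
  have [I [e [eP eQ]]] := IHk; exists I, e; split=> // i j _; apply: eQ.
  exact: leq_trans (ltn_ord j) nk.
apply: (locally_bind (Q' := fun=> Q (Ordinal kn)) IHk) (fun _ _ _ => Ql (Ordinal kn)) _ => e a ee aa eQ aQ i.
rewrite ltnS leq_eqVlt => /orP[/eqP ik|ik]; last exact/QM/eQ.
by rewrite mulrC; apply: QM => //; rewrite (_ : i = Ordinal kn) //; apply/val_inj.
Qed.

End Locally.

Section Structure.
Variable A : comPzRingType.

(* On the factor of A cut out by the idempotent e, f is c t^l (1 + x) with c
   invertible. *)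
Definition structured n (e : A) (f : iter_laurent A n) (l : 'cV[int]_n) :=
  exists (c c' : A) (x : iter_laurent A n),
    [/\ e * (c * c') = e, top_nilpotent x,
        forall l', lexlt l' 0 \/ l' = 0 -> nilpotent_elt (icoef x l')
      & constL n e * f = constL n e * (monomial c l * (1 + x))].

Lemma structuredM n (e a : A) (f : iter_laurent A n) l :
  structured e f l -> structured (e * a) f l.
Proof.
move=> [c [c' [x [ec xT xn ef]]]]; exists c, c', x; split=> //.
  by rewrite mulrAC ec.
by rewrite rmorphM mulrAC ef mulrAC.
Qed.

Lemma constL_inj n : injective (@constL A n).
Proof. by move=> a b /(congr1 (fun f : iter_laurent A n => icoef f 0)); rewrite !icoef_mono eqxx. Qed.

(** Divided by its leading monomial, f splits along the outer exponent into a nilpotent part below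
    i, the factor 1 + x at i, and a part of positive order; the first and the last join x in the new
    perturbation. *)
Lemma structured_cons n (f : iter_laurent A n.+1) (i : int) (e a : A)
    (u : iter_laurent A n) l :
  let g : laurent (iter_laurent_ring A n) := f in e * e = e ->
  constL n e * (g i : iter_laurent A n) = constL n e * u ->
  (forall j, j < i -> nilpotent_elt (constL n e * (g j : iter_laurent A n))) ->
  structured a u l -> structured (e * a) f (exp_cons i l).
Proof.
pose R := iter_laurent_ring A n.
move=> g ee gi gn [c [c' [x [ac xT xn au]]]].
pose E1 : laurent R := constL n.+1 e; pose E2 : laurent R := constL n.+1 a.
pose T : laurent R := lmono (monomial c l : R) i.
pose T' : laurent R := lmono (monomial c' (- l) : R) (- i).
pose up : laurent R := truncation (fun k => i < k) g.
(* The coefficients below i are nilpotent only after multiplication by e, which is therefore built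
   in. *)
pose lo : laurent R := truncation (fun k => k < i) (E1 * g).
have E1E k (h : laurent R) : (E1 * h) k = (constL n e : R) * h k.
  by rewrite /E1 constLS lcoefM_lmono subr0.
have lon : nilpotent_elt lo.
  by apply: nilpotent_truncation => j ji; rewrite E1E; apply: gn.
have T'upE k : (T' * up) k = (monomial c' (- l) : R) * up (k + i).
  by rewrite lcoefM_lmono opprK.
pose z : laurent R := lmono (x : R) 0 + T' * up.
have T'lon : nilpotent_elt (T' * lo) by apply: nilpotentM.
exists c, c', (T' * lo + z : laurent R); split.
- by rewrite -mulrA ac.
- apply: (@top_nilpotentD_nilpotent A n.+1) => //; apply: top_nilpotent_cons => [k k0|].
    rewrite lcoefD T'upE truncationE /= lt_eqF // ifF ?mulr0 ?addr0 //; lia.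
  by rewrite lcoefD T'upE truncationE /= add0r ltxx mulr0 addr0.
- move=> l' l'0; rewrite icoefD; apply: nilpotentD; first exact: nilpotent_icoef.
  rewrite icoef_consE lcoefD T'upE truncationE /=.
  (* A multi-index at most 0 has outer exponent at most 0, where the part of positive order has no
     coefficient. *)
  have l0 : l' ord_max 0 <= 0.
    by case: l'0 => [/= /orP[/ltW|/andP[/eqP + _]]|->]; rewrite ?mxE // => ->.
  have -> : (i < l' ord_max 0 + i) = false by rewrite -subr_gt0 addrK le_gtF.
  rewrite mulr0 addr0.
  case: eqP => l'm; last by rewrite icoef0; apply: nilpotent0.
  apply: xn; have r0 : row' ord_max (0 : 'cV[int]_n.+1) = 0 by apply/colP => j; rewrite !mxE.
  by case: l'0 => [/=|->]; rewrite ?r0; [rewrite l'm mxE ltxx eqxx; left | right].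
rewrite rmorphM -[LHS]/(E1 * E2 * g) -[RHS]/(E1 * E2 * (monomial c (exp_cons i l) * (1 + (T' * lo + z)))).
have -> : monomial c (exp_cons i l) = T :> laurent R.
  by rewrite /= exp_cons_max row'_exp_cons.
have E1E1 : E1 * E1 = E1.
  have H : constL n.+1 e * constL n.+1 e = constL n.+1 e by rewrite -rmorphM ee.
  exact: H.
have T'TE2 : E2 * (T * T') = E2.
  rewrite /T /T' lmonoM -[monomial c l * _]/(monomial c l * monomial c' (- l) : iter_laurent A n).
  rewrite monomialM !subrr -[X in lmono X 0]/(constL n (c * c')) /E2 constLS lmonoM addr0.
  have EA : constL n a * constL n (c * c') = constL n a by rewrite -rmorphM ac.
  by congr (lmono _ _); exact: EA.
have E12i : E1 * E2 * lmono (g i) i = E1 * E2 * (T * (1 + lmono (x : R) 0)).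
  rewrite /E1 /E2 !constLS lmonoM -[1]/(lmono 1 0) -lmonoD !lmonoM !addr0 !add0r.
  congr (lmono _ _).
  rewrite -[LHS]/(constL n e * constL n a * (g i : iter_laurent A n)).
  rewrite -[RHS]/(constL n e * constL n a * (monomial c l * (1 + x))).
  by rewrite mulrAC gi -mulrA -au; ring.
have lo2 : lo = E1 * truncation (fun k => k < i) g.
  by apply: laurentP => k; rewrite E1E !truncationE E1E; case: ifP; rewrite ?mulr0.
transitivity (E1 * E2 * truncation (fun k => k < i) g + E1 * E2 * lmono (g i) i
  + E1 * E2 * up); first by rewrite -!mulrDr -truncation_split.
rewrite E12i /z lo2; transitivity (E1 * E2 * (T * (1 + lmono (x : R) 0)) +
  (E1 * E1) * (E2 * (T * T')) * truncation (fun k => k < i) g +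
  E1 * (E2 * (T * T')) * up); last by ring.
by rewrite E1E1 T'TE2; ring.
Qed.

(** The products F_i H_(-i) of outer coefficients sum to 1 and are orthogonal modulo nilpotents,
    hence yield idempotents of the coefficient ring, which are constants from A. On the factor of
    index i, F_i is invertible and the F_j with j < i are nilpotent, so the induction applies to
    F_i. *)
Lemma unit_locally_structured n (f h : iter_laurent A n) :
  f * h = 1 -> locally (fun e => exists l, structured e f l).
Proof.
elim: n f h => [|n IHn] f h fh.
  apply: locally1; exists 0, f, h, 0; split; rewrite ?mul1r ?addr0 ?mulr1 //.
    exact: top_nilpotent0.
  by move=> l' _; rewrite icoef0; apply: nilpotent0.
pose R := iter_laurent_ring A n; pose F : laurent R := f; pose H : laurent R := h.
have FH : F * H = 1 := fh.
have [[N FN] [M HM]] := (laurent_bound F, laurent_bound H).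
pose m := (absz (N + M)%R).+1; pose idx (i : 'I_m) := N + i%:Z.
pose e i : R := F (idx i) * H (- idx i).
have e1 : \sum_i e i = 1.
  transitivity ((F * H) 0); last by rewrite FH.
  rewrite (@lcoefM_fin _ F H 0 N M m N) //; last by rewrite /m; lia.
  by apply: eq_bigr => i _; rewrite /e /idx; congr (F _ * H _); lia.
have en i j : i != j -> nilpotent_elt (e i * e j).
  move=> ij; have [ltij|ltji|E] := ltngtP i j; last by case/eqP: ij; apply: val_inj.
    rewrite (_ : _ * _ = (F (idx j) * H (- idx i)) * (F (idx i) * H (- idx j))); last by rewrite /e; ring.
    by apply: nilpotentM; apply: laurent_unit_nilpotent FH _; rewrite /idx; lia.
  rewrite (_ : _ * _ = (F (idx i) * H (- idx j)) * (F (idx j) * H (- idx i))); last by rewrite /e; ring.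
  by apply: nilpotentM; apply: laurent_unit_nilpotent FH _; rewrite /idx; lia.
have [s [sM s1]] := lift_idem_partition e1 en.
have /choice[a aE] i : exists a, a * a = a /\ s i * e i = constL n a.
  have [|a aa ae] := @iter_laurent_idem A n (s i * e i); last by exists a.
  by have := sM i i; rewrite eqxx.
have aP : idem_partition a.
  split=> [i j|]; apply: (@constL_inj n).
    rewrite rmorphM /= -(aE i).2 -(aE j).2 [LHS]sM; case: eqP; rewrite ?rmorph0 ?(aE i).2 //.
  by rewrite raddf_sum /= rmorph1 -[RHS]s1; apply: eq_bigr => i _; rewrite (aE i).2.
pose Q b := exists (i : int) (u u' : iter_laurent A n),
  [/\ u * u' = 1, constL n b * (F i : iter_laurent A n) = constL n b * u
    & forall j, j < i -> nilpotent_elt (constL n b * (F j : iter_laurent A n))].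
have Ql : locally Q.
  exists 'I_m, a; split=> // i; exists (idx i).
  have [aa sa] := aE i.
  have cc : constL n (a i) * constL n (a i) = constL n (a i) by rewrite -rmorphM aa.
  (* Off the factor, u and its inverse are completed by 1, so that u is invertible in the whole
     ring, as the induction hypothesis requires. *)
  exists (constL n (a i) * (F (idx i) : iter_laurent A n) + (1 - constL n (a i))).
  exists (constL n (a i) * (s i * H (- idx i) : iter_laurent A n) + (1 - constL n (a i))).
  set c := constL n (a i) in cc *.
  have cE : c * ((F (idx i) : iter_laurent A n) * (s i * H (- idx i) : iter_laurent A n)) = c.
    rewrite -[RHS]cc {3}/c -sa; congr (_ * _).
    by rewrite mulrCA.
  split.
  - transitivity (c * c * ((F (idx i) : iter_laurent A n) * (s i * H (- idx i) : iter_laurent A n))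
      + (c - c * c) * ((F (idx i) : iter_laurent A n) + (s i * H (- idx i) : iter_laurent A n))
      + (1 - c - c + c * c)); first by ring.
    by rewrite cc cE subrr mul0r addr0 subrK addrC subrK.
  - by rewrite mulrDr mulrA cc mulrBr mulr1 cc subrr addr0.
  move=> j ji; rewrite /c -sa; apply: (@nilpotent_prime R _).2 => p.
  have /nilpotent_prime/(_ p) pn : nilpotent_elt (F j * H (- idx i)).
    by apply: laurent_unit_nilpotent FH _; lia.
  have E : s i * e i * F j = (s i * F (idx i)) * (F j * H (- idx i)) by rewrite /e; ring.
  have pE : p (s i * e i * F j) by rewrite E; apply: primeM.
  exact: pE.
apply: (locally_bind (Q' := fun b c => exists i u l,
  [/\ constL n b * (F i : iter_laurent A n) = constL n b * u,
    forall j, j < i -> nilpotent_elt (constL n b * (F j : iter_laurent A n))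
  & structured c u l]) Ql).
  move=> b bb [i [u [u' [uu' bu bn]]]]; have [J [d [dP dQ]]] := IHn u u' uu'.
  by exists J, d; split=> // j; have [l ul] := dQ j; exists i, u, l.
move=> b c bb cc _ [i [u [l [bu bn ul]]]]; exists (exp_cons i l).
exact: structured_cons bb bu bn ul.
Qed.

End Structure.

(** * Locally constant functions and leading exponents *)

Section CornerRing.
Variables (A : comPzRingType) (e : A).

Definition corner_pred : {pred A} := fun x => e * x == x.

Fact corner_pred_zmod_closed : zmod_closed corner_pred.
Proof.
split=> [|x y /eqP ex /eqP ey]; first by rewrite unfold_in mulr0.
by rewrite unfold_in mulrBr ex ey.
Qed.

HB.instance Definition _ := GRing.isZmodClosed.Build A corner_pred
  corner_pred_zmod_closed.

(** The ring e A with unit e: the definitions of nu and of [locZ_to] ask for genuine factor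
    rings. *)
Record corner (ee : e * e = e) := Corner { corner_val : A ; _ : corner_val \in corner_pred }.

Variable ee : e * e = e.

HB.instance Definition _ := [isSub for @corner_val ee].
HB.instance Definition _ := [Choice of corner ee by <:].
HB.instance Definition _ := [SubChoice_isSubZmodule of corner ee by <:].

Implicit Types x y z : corner ee.

Lemma corner_valP x : e * corner_val x = corner_val x.
Proof. exact/eqP/(valP x). Qed.

Fact corner_proj_subproof a : e * a \in corner_pred.
Proof. by rewrite unfold_in mulrA ee. Qed.

Definition corner_proj a : corner ee := Corner ee (corner_proj_subproof a).

Definition corner_mul x y := corner_proj (corner_val x * corner_val y).

Lemma corner_ext x y : corner_val x = corner_val y -> x = y.
Proof. exact: val_inj. Qed.

Fact corner_mulA : associative corner_mul.
Proof.
by move=> x y z; apply: corner_ext; rewrite /= !mulrA -(corner_valP x) !mulrA ee; ring.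
Qed.

Fact corner_mulC : commutative corner_mul.
Proof. by move=> x y; apply: corner_ext; rewrite /= (mulrC (corner_val x)). Qed.

Fact corner_mul1 : left_id (corner_proj 1) corner_mul.
Proof. by move=> x; apply: corner_ext; rewrite /= mulr1 !corner_valP. Qed.

Fact corner_mulDl : left_distributive corner_mul +%R.
Proof. by move=> x y z; apply: corner_ext; rewrite /= -mulrDr -mulrDl. Qed.

HB.instance Definition _ := GRing.Zmodule_isComPzRing.Build (corner ee)
  corner_mulA corner_mulC corner_mul1 corner_mulDl.

Fact corner_proj_is_zmod_morphism : zmod_morphism corner_proj.
Proof. by move=> a b; apply: corner_ext; rewrite /= mulrBr. Qed.

Fact corner_proj_is_monoid_morphism : monoid_morphism corner_proj.
Proof.
split=> // a b; apply: corner_ext => /=.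
by transitivity (e * e * e * (a * b)); [rewrite !ee | ring].
Qed.

HB.instance Definition _ := GRing.isZmodMorphism.Build A (corner ee) corner_proj
  corner_proj_is_zmod_morphism.
HB.instance Definition _ := GRing.isMonoidMorphism.Build A (corner ee) corner_proj
  corner_proj_is_monoid_morphism.

End CornerRing.

Section PartitionTheory.
Variables (A : comPzRingType).

Lemma partition_idem (I : finType) (e : I -> A) : idem_partition e ->
  forall i, e i * e i = e i.
Proof. by move=> [eM _] i; rewrite eM eqxx. Qed.

Lemma partition_ext (I : finType) (e : I -> A) x y : idem_partition e ->
  (forall i, e i * x = e i * y) -> x = y.
Proof.
move=> [_ e1] exy; rewrite -[x]mul1r -[y]mul1r -e1 !mulr_suml.
by apply: eq_bigr => i _.
Qed.

Lemma partition_prime (I : finType) (e : I -> A) (p : Spec A) : idem_partition e ->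
  exists i, ~ p (e i).
Proof.
move=> [_ e1]; apply/existsNP => pe; apply: (@prime1 _ p); rewrite -e1.
exact: prime_sum.
Qed.

Lemma partition_prime_unique (I : finType) (e : I -> A) (p : Spec A) i j :
  idem_partition e -> ~ p (e i) -> ~ p (e j) -> i = j.
Proof.
move=> [eM _] pi pj; apply/eqP; apply/negPn/negP => ij.
have /prime_or[//|//] : p (e i * e j) by rewrite eM (negPf ij); apply: prime0.
Qed.

Lemma partition_ord (I : finType) (e : I -> A) : idem_partition e ->
  idem_partition (fun i : 'I_#|I| => e (enum_val i)).
Proof.
move=> [eM e1]; split=> [i j|]; first by rewrite eM (inj_eq enum_val_inj).
by rewrite -[RHS]e1 (reindex (@enum_val I I)) //; apply/onW_bij/enum_val_bij.
Qed.

Variables (m : nat) (e : 'I_m -> A).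
Hypothesis eP : idem_partition e.

Definition factor i : comPzRingType := corner (partition_idem eP i).

Definition factor_proj i : {rmorphism A -> factor i} :=
  @corner_proj A (e i) (partition_idem eP i).

Lemma factor_decomposition : decomposition factor_proj.
Proof.
exists (fun f : forall i, factor i => \sum_i corner_val (f i)) => [a|f].
  by rewrite /= -mulr_suml eP.2 mul1r.
apply: functional_extensionality_dep => i; apply: corner_ext.
rewrite /= (bigD1 i) //= mulrDr corner_valP mulr_sumr big1 ?addr0 // => j ji.
by rewrite -corner_valP mulrA eP.1 eq_sym (negPf ji) mul0r.
Qed.

Lemma Spec_map_factor i (q : Spec (factor i)) : ~ Spec_map (factor_proj i) q (e i).
Proof.
move=> qi; apply: (@prime1 _ q).
have -> : 1 = factor_proj i (e i) by apply: corner_ext; rewrite /= mulr1 partition_idem.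
exact: qi.
Qed.

Lemma locZ_exists (z : 'I_m -> int) :
  exists c : locZ A, forall i (p : Spec A), ~ p (e i) -> c p = z i.
Proof.
have /choice[idx idxP] (p : Spec A) := partition_prime p eP.
have cP : (fun p => z (idx p)) \in loc_const A.
  apply/asboolP => p.
  exists [set q : Spec A | ~ q (e (idx p))]%classic; split=> //.
    exists [set e (idx p)]%classic; apply/seteqP; split=> q /= qe.
      by move=> /(_ _ erefl)/qe.
    by move=> pe; apply: qe => _ ->.
    exact: idxP.
by move=> q /= qe; congr z; apply: partition_prime_unique eP (idxP q) qe.
exists (LocZ cP) => i p pe /=; congr z.
exact: partition_prime_unique eP (idxP p) pe.
Qed.

End PartitionTheory.

(** [locZ_to] may rest on a decomposition unrelated to e. On each of its factors B_k the image of
    e_i is 0 or a non-nilpotent idempotent; in the second case some prime of B_k avoids it, and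
    evaluating c there identifies the two values. *)
Lemma locZ_toE (A : comPzRingType) (c : locZ A) (I : finType) (e : I -> A) (z : I -> int) :
  idem_partition e -> (forall i (p : Spec A), ~ p (e i) -> c p = z i) ->
  forall i, e i * locZ_to c = e i *~ z i.
Proof.
move=> eP cz.
have [a [m [B [pr [z' [dec val za]]]]]] : exists a : A,
    exists (m : nat) (B : 'I_m -> comPzRingType) (pr : forall i, {rmorphism A -> B i})
      (z : 'I_m -> int),
    [/\ decomposition pr, has_values pr c z & forall i, pr i a = (z i)%:~R].
  have eP' := partition_ord eP.
  exists (\sum_i e i *~ z i), #|I|, (factor eP'), (factor_proj eP'), (z \o enum_val).
  split=> [|i q|i]; first exact: factor_decomposition.
    exact/cz/(@Spec_map_factor _ _ _ eP').
  apply: corner_ext; rewrite -[in RHS](rmorph_int (factor_proj eP' i)) /=.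
  rewrite mulr_sumr (bigD1 (enum_val i)) //= big1 ?addr0 => [|j ji].
    by rewrite mulrzAr (partition_idem eP) mulrzr.
  by rewrite mulrzAr eP.1 eq_sym (negPf ji) mul0rz.
have ca : exists m B pr z, [/\ @decomposition A m B pr, has_values pr c z
    & forall i, pr i (locZ_to c) = (z i)%:~R].
  rewrite /locZ_to; case: xgetP => [b _ [m' [B' [pr' [z1 H]]]]|/(_ a) []].
    by exists m', B', pr', z1.
  by exists m, B, pr, z'.
move: ca => {m B pr z' dec val za} [m [B [pr [z' [dec val za]]]]] i.
apply: (bij_inj dec); apply: functional_extensionality_dep => k.
rewrite !rmorphM /= za -[e i *~ z i]mulrzr rmorphM rmorph_int.
have [->|ek0] := pselect (pr k (e i) = 0); first by rewrite !mul0r.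
have [q qe] : exists q : Spec (B k), ~ q (pr k (e i)).
  apply: not_nilpotent_prime => /nilpotent_idem ek; apply/ek0/ek.
  by rewrite -rmorphM (partition_idem eP).
by rewrite -(val k q) (cz i).
Qed.

Lemma nilpotent_unit (R : comPzRingType) (x : R) :
  nilpotent_elt x -> exists w, w * (1 + x) = 1.
Proof.
move=> [k xk]; have := subrX1 (- x) k; rewrite exprNn xk mulr0 sub0r => E.
exists (\sum_(i < k) (- x) ^+ i); apply: oppr_inj; rewrite E; ring.
Qed.

Section LeadingExponent.
Variables (A : comPzRingType) (n : nat).
Local Notation L := (iter_laurent A n).
Implicit Types (f : L) (p : Spec A) (l : 'cV[int]_n).

(** The value of nu at the point p, expressed by membership in p alone; being unique, it compares
    different decompositions. *)
Definition lead_exponent p f l :=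
  ~ p (icoef f l) /\ forall l', lexlt l' l -> p (icoef f l').

Lemma lexlt_total m (l l' : 'cV[int]_m) : l != l' -> lexlt l l' || lexlt l' l.
Proof.
elim: m l l' => [|m IHm] l l'; first by rewrite (flatmx0 l) (flatmx0 l') eqxx.
move=> ll' /=; have [||E] := ltgtP; rewrite ?orbT //=.
apply: IHm; apply: contraNneq ll' => E'.
by rewrite -(exp_consK l) -(exp_consK l') E E'.
Qed.

Lemma lexlt_irr m (l : 'cV[int]_m) : lexlt l l = false.
Proof. by elim: m l => //= m IHm l; rewrite ltxx eqxx IHm. Qed.

Lemma lexlt_sub m (l l' : 'cV[int]_m) : lexlt l l' -> lexlt (l - l') 0.
Proof.
elim: m l l' => [//|m IHm] l l' /= /orP[ll'|/andP[/eqP ll' /IHm H]]; rewrite !mxE.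
  by rewrite subr_lt0 ll'.
rewrite ll' subrr ltxx eqxx /= (_ : row' _ 0 = 0); last by apply/colP => j; rewrite !mxE.
by rewrite (_ : row' _ _ = row' ord_max l - row' ord_max l') //; apply/colP => j; rewrite !mxE.
Qed.

Lemma lead_exponent_unique p f l l' :
  lead_exponent p f l -> lead_exponent p f l' -> l = l'.
Proof.
move=> [fl lf] [fl' lf']; apply/eqP/negPn/negP => /lexlt_total/orP[/lf'|/lf] //.
Qed.

Lemma structured_coef (e c : A) (f x : L) l l' :
  constL n e * f = constL n e * (monomial c l * (1 + x)) ->
  e * icoef f l' = e * c * ((l' == l)%:R + icoef x (l' - l)).
Proof.
move=> ef; rewrite -icoef_constM ef icoef_constM icoef_monoM mulrA icoefD.
rewrite -(monomial1 A n) icoef_mono subr_eq0; congr (_ * (_ + _)).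
by case: eqP.
Qed.

Lemma structured_lead_exponent e p f l :
  structured e f l -> ~ p e -> lead_exponent p f l.
Proof.
move=> [c [c' [x [ec _ xn ef]]]] pe.
have xp l' : lexlt l' 0 \/ l' = 0 -> p (icoef x l') by move=> /xn/nilpotent_prime.
split=> [pf|l' ll'].
  apply: pe; rewrite -ec mulrA; apply: primeMr.
  have := structured_coef l ef; rewrite eqxx subrr mulrDr mulr1 => E.
  apply: (@primeDr _ p _ (e * c * icoef x 0)); first by rewrite -E; apply: primeM.
  by apply/primeM/xp; right.
have /prime_or[//|//] : p (e * icoef f l').
rewrite (structured_coef l' ef) (_ : (l' == l) = false) ?add0r; last first.
  by apply/negP => /eqP E; move: ll'; rewrite E lexlt_irr.
by apply/primeM/xp; left; apply: lexlt_sub.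
Qed.

(** The prime p misses some idempotent e_i of the decomposition and so comes from a prime q of the
    factor B_i, where the nilpotency and invertibility conditions can be read. *)
Lemma is_nu_lead_exponent f v p : is_nu f v -> lead_exponent p f (\col_j v j 0 p).
Proof.
move=> [m [B [pr [l [dec nil inv val]]]]].
have [g prK gK] := dec.
pose e i : A := g (fun j => (j == i)%:R).
have eE i j : pr j (e i) = (j == i)%:R by rewrite -[LHS]/((fun j => pr j (e i)) j) gK.
have e1 : \sum_i e i = 1.
  apply: (bij_inj dec); apply: functional_extensionality_dep => j.
  rewrite rmorph_sum rmorph1 (bigD1 j) //= eE eqxx big1 ?addr0 // => i ij.
  by rewrite eE eq_sym (negPf ij).
have [i pe] : exists i, ~ p (e i).
  by apply/existsNP => pe; apply: (@prime1 _ p); rewrite -e1; apply: prime_sum.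
have ext a b : pr i a = pr i b -> e i * a = e i * b.
  move=> ab; apply: (bij_inj dec); apply: functional_extensionality_dep => j.
  rewrite !rmorphM eE; case: eqP => [->|_]; rewrite ?mul0r //.
  by rewrite ab.
have surj (b : B i) : exists a, pr i a = b.
  exists (g (dfwith (fun j => 0 : B j) b)).
  by rewrite -[LHS]/((fun j => pr j (g (dfwith (fun j => 0 : B j) b))) i) gK dfwith_in.
(* The prime of B_i corresponding to p; multiplying by e_i makes the test independent of the
   preimage a. *)
pose Q : set (B i) := [set b | exists2 a, pr i a = b & p (e i * a)]%classic.
have QE a : Q (pr i a) -> p a.
  by move=> [a' /ext aa']; rewrite aa' => /prime_or[].
have QP : prime_ideal Q.
  split.
  - by exists 0; rewrite ?rmorph0 // mulr0; apply: prime0.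
  - move=> _ _ [a <- pa] [b <- pb]; exists (a + b); first by rewrite rmorphD.
    by rewrite mulrDr; apply: primeD.
  - move=> b _ [a <- pa]; have [b' <-] := surj b; exists (b' * a); first by rewrite rmorphM.
    by rewrite mulrCA; apply: primeM.
  - by rewrite -(rmorph1 (pr i)) => /QE; apply: prime1.
  move=> x y; have [a <-] := surj x; have [b <-] := surj y.
  rewrite -rmorphM => /QE/prime_or[pa|pb]; [left; exists a|right; exists b] => //;
    exact: primeM.
pose q := MkSpec QP.
have qp : Spec_map (pr i) q = p.
  have E : prime_set (Spec_map (pr i) q) = prime_set p.
    apply/seteqP; split=> a /=; first exact: QE.
    by move=> pa; exists a => //; apply: primeM.
  case: (Spec_map _ _) E => P1 H1 /=; case: (p) => P2 H2 /= E.
  by case: P2 / E in H2 *; congr MkSpec; apply: Prop_irrelevance.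
have -> : \col_j v j 0 p = l i.
  by apply/colP => j; rewrite mxE -qp (val j i q).
split=> [pf|l' ll'].
  have [y yf] := inv i; apply: (@prime1 _ q); rewrite -yf; apply: primeM.
  by exists (icoef f (l i)) => //; apply: primeM.
by apply: QE; have /nilpotent_prime/(_ q) := nil i l' ll'.
Qed.

Lemma is_nu_exists f h : f * h = 1 -> exists v, is_nu f v.
Proof.
move=> /unit_locally_structured[I [e [eP /choice[l lP]]]].
have eP' := partition_ord eP.
have /choice[v vP] (j : 'I_n) := locZ_exists eP' (fun i => l (enum_val i) j 0).
exists (\col_j v j), #|I|, (factor eP'), (factor_proj eP'), (l \o enum_val).
split=> [|i l' ll'|i|j i q].
- exact: factor_decomposition.
- have [c [c' [x [_ _ xn ef]]]] := lP (enum_val i).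
  rewrite (_ : factor_proj _ _ _ = factor_proj eP' i (c * icoef x (l' - l (enum_val i)))).
    have /(nilpotentM c)[k xk] := xn _ (or_introl (lexlt_sub ll')).
    by exists k; rewrite -rmorphXn xk rmorph0.
  apply: corner_ext; rewrite /= (structured_coef l' ef) mulrA.
  case: eqP => [E|_]; last by rewrite add0r.
  by move: ll'; rewrite E lexlt_irr.
- have [c [c' [x [ec _ xn ef]]]] := lP (enum_val i).
  (* The leading coefficient is c (1 + x_0) on this factor, with x_0 nilpotent. *)
  have [w wx] := nilpotent_unit (xn 0 (or_intror erefl)).
  exists (factor_proj eP' i (c' * w)); apply: corner_ext; rewrite /=.
  rewrite (structured_coef _ ef) eqxx subrr mulr1n mulr1.
  transitivity (e (enum_val i) * (e (enum_val i) * e (enum_val i) * (c * c') * (w * (1 + icoef x 0)))).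
    by ring.
  by rewrite wx mulr1 !(partition_idem eP) ec (partition_idem eP).
by rewrite mxE; apply: vP; apply: Spec_map_factor.
Qed.

Lemma nuP f h : f * h = 1 -> is_nu f (nu f).
Proof. by move=> /is_nu_exists[v fv]; rewrite /nu; case: xgetP => [u _|/(_ v)]. Qed.

End LeadingExponent.

Section Residue.
Variables (A : comPzRingType) (n : nat).
Local Notation L := (iter_laurent A n).
Variable G : 'cV[int]_n -> L.
Hypothesis G0 : G 0 = 1.
Hypothesis GD : forall a b, G (a + b) = G a * G b.

(** On the factor of e the series is c t^l (1 + x), whose logarithmic derivative is l plus that of 1
    + x, and the latter is exact. *)
Lemma structured_dlog_row (e : A) i l :
  structured e (G (delta_mx i 0)) l ->
  exact_like (constL n e *: (dlog_row G i - int_row A (fun j => l j 0))).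
Proof.
move=> [c [c' [x [ec xT xn eg]]]]; set g := G _ in eg *.
pose g' := G (- delta_mx i 0).
have gg' : g * g' = 1 by apply: (GV G0 GD).
(* On the factor of e this is the inverse of 1 + x. *)
pose y := g' * monomial c l.
have ey : constL n e * (y * (1 + x)) = constL n e.
  rewrite /y -mulrA mulrCA -eg mulrCA (mulrC g') gg' mulr1.
  by [].
have -> : constL n e *: (dlog_row G i - int_row A (fun j => l j 0)) =
    constL n e *: (y *: euler_row x).
  apply/rowP => j; rewrite !mxE -/g -/g'.
  have ed : constL n e * eulerd j g = constL n e *
      (monomial c l *~ l j 0 * (1 + x) + monomial c l * eulerd j x).
    rewrite -eulerd_constM eg eulerd_constM eulerdM eulerd_mono raddfD /= eulerd1 add0r.
    by [].
  rewrite mulrBr /dlog -/g -/g' mulrCA ed mulrDr mulrDr mulrzAl.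
  rewrite (_ : g' * (constL n e * (monomial c l * (1 + x) *~ l j 0)) = constL n e * (l j 0)%:~R).
    by rewrite addrC addKr /y; ring.
  rewrite -[in RHS]ey /y mulrzr !mulrzAr; congr (_ *~ _); ring.
exact: exact_like_log1p xT ey.
Qed.

End Residue.

(** * The residue formula *)

Section Evaluation.
Variables (A : comPzRingType) (p : Spec A).

Definition locZ_eval (c : locZ A) : int := c p.

Lemma locZ_eval_is_zmod_morphism : zmod_morphism locZ_eval. Proof. by []. Qed.

Lemma locZ_eval_is_monoid_morphism : monoid_morphism locZ_eval. Proof. by []. Qed.

HB.instance Definition _ := GRing.isZmodMorphism.Build (locZ A) int locZ_eval
  locZ_eval_is_zmod_morphism.
HB.instance Definition _ := GRing.isMonoidMorphism.Build (locZ A) int locZ_eval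
  locZ_eval_is_monoid_morphism.

End Evaluation.

Section ContinuousHomomorphism.
Variables (A : comPzRingType) (n : nat).
Local Notation L := (iter_laurent A n).
Variable phi : {rmorphism L -> L}.
Hypothesis phi_alg : forall a : A, phi (constL n a) = constL n a.
Hypothesis phi_cont : continuous phi.

Let G (a : 'cV[int]_n) : L := phi (monomial 1 a).

Let G0 : G 0 = 1. Proof. by rewrite /G monomial1 rmorph1. Qed.

Let GD a b : G (a + b) = G a * G b.
Proof. by rewrite /G -rmorphM monomialM mulr1. Qed.

Lemma phi_monomial c a : phi (monomial c a) = constL n c * G a.
Proof. by rewrite monomialE rmorphM /= phi_alg. Qed.

Lemma vanishes_near0_phi (V : zmodType) (T : L -> V) :
  vanishes_near0 T -> vanishes_near0 (T \o phi).
Proof.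
move=> [lam T0]; have [|mu muP] := @phi_cont 0 (Ulambda lam).
  by rewrite rmorph0; exists lam => g; rewrite subr0.
by exists mu => f Uf; apply/T0/muP; rewrite subr0.
Qed.

(** The entry d g_i / d t_j is g_i W_ij / t_j, so row and column factors come out of the
    determinant. *)
Lemma jacobian_phi : jacobian (fun i => phi (tvar A i)) =
  G (const_mx 1) * monomial 1 (const_mx (-1)) * \det (rows_mx (dlog_row G)).
Proof.
have sum1 : \sum_i delta_mx i 0 = const_mx 1 :> 'cV[int]_n.
  apply/colP => j; rewrite summxE mxE (bigD1 j) //= mxE !eqxx big1 ?addr0 // => i ij.
  by rewrite mxE eq_sym (negPf ij).
have prodG : \prod_i G (delta_mx i 0) = G (const_mx 1).
  rewrite -sum1; elim: (index_enum _) => [|i r IHr]; first by rewrite !big_nil G0.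
  by rewrite !big_cons GD IHr.
have prodT : \prod_i monomial 1 (- delta_mx i 0) = monomial 1 (const_mx (-1)) :> L.
  have -> : const_mx (-1) = - \sum_i delta_mx i 0 :> 'cV[int]_n.
    by rewrite sum1; apply/colP => j; rewrite !mxE.
  elim: (index_enum _) => [|i r IHr]; first by rewrite !big_nil oppr0 monomial1.
  by rewrite !big_cons IHr monomialM mulr1 opprD.
rewrite /jacobian (_ : \matrix_(i, j) _ =
  diag_mx (\row_i G (delta_mx i 0)) *m rows_mx (dlog_row G) *m
  diag_mx (\row_j monomial 1 (- delta_mx j 0))); last first.
  apply/matrixP => i j; rewrite mul_mx_diag mul_diag_mx !mxE pderivE /dlog.
  rewrite (mulrA (G _)) (GV G0 GD) mul1r mulrC.
  by [].
rewrite !det_mulmx !det_diag.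
under eq_bigr do rewrite mxE.
under [X in _ * X]eq_bigr do rewrite mxE.
by rewrite prodG prodT mulrAC.
Qed.

Lemma locally_structured_phi :
  locally (fun e => forall i : 'I_n, exists l, structured e (G (delta_mx i 0)) l).
Proof.
apply: (@locally_all A n (fun i e => exists l, structured e (G (delta_mx i 0)) l)).
  by move=> i e a _ [l el]; exists l; apply: structuredM.
by move=> i; apply: unit_locally_structured (GV G0 GD (delta_mx i 0)).
Qed.

Lemma residue_phi l : icoef (G l * \det (rows_mx (dlog_row G))) 0 =
  if l == 0 then locZ_to (dphi phi) else 0.
Proof.
have [I [e [eP eQ]]] := locally_structured_phi.
have exL (i : I) : exists L' : 'I_n -> 'cV[int]_n,
    forall j, structured (e i) (G (delta_mx j 0)) (L' j).
  by have [L' LP] := choice (eQ i); exists L'.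
have {exL} [L' LP] := choice exL.
have exactL i j := structured_dlog_row G0 GD (LP i j).
case: eqP => [->|/eqP l0]; last first.
  apply: (residue_dlog_eq0 G0 GD) => // j.
  (* The row is an integer row plus an exact one only factor by factor, so it is first cut up by the
     partition. *)
  have -> : dlog_row G j = \sum_i constL n (e i) *: dlog_row G j.
    by rewrite -scaler_suml -rmorph_sum eP.2 rmorph1 scale1r.
  elim: (index_enum _) => [|i r IHr].
    rewrite big_nil (_ : 0 = int_row A (fun=> 0)); first exact: log_like_int.
    by apply/rowP => k; rewrite !mxE.
  rewrite big_cons; apply: log_likeD => //.
  rewrite -[dlog_row G j](subrK (int_row A (fun k => L' i j k 0))) scalerDr.
  by apply: log_likeD; [exact: exact_log_like | apply/log_likeZ/log_like_int].
rewrite G0 mul1r -/(rdet _); apply: (partition_ext eP) => i.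
rewrite (residue_dlog_det G0 GD (partition_idem eP i) (exactL i)) mulrzr.
rewrite (locZ_toE (z := fun i => \det (\matrix_(j, k) L' i j k 0)) eP) // => {}i p pe.
(* Evaluation at p is a ring morphism and passes inside the determinant; [Upsilon] has the exponents
   as columns, here they are rows, whence the transpose. *)
rewrite -[LHS]/(locZ_eval p (dphi phi)) -det_map_mx -det_tr; congr (\det _).
apply/matrixP => j k; rewrite !mxE.
have jG : G (delta_mx j 0) * G (- delta_mx j 0) = 1 := GV G0 GD _.
have := lead_exponent_unique (is_nu_lead_exponent p (nuP jG))
  (structured_lead_exponent (LP i j) pe).
by move=> /(congr1 (fun v : 'cV_n => v k 0)); rewrite mxE.
Qed.

(** Both sides are additive and continuous in f, which may thus be a monomial c t^l; by
    [jacobian_phi] the left side is then c times the constant term of G(l + 1) det W, where l + 1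
    adds 1 to every exponent. *)
Lemma residue_pullback f :
  icoef (phi f * jacobian (fun i => phi (tvar A i))) (const_mx (-1)) =
    locZ_to (dphi phi) * icoef f (const_mx (-1)).
Proof.
pose T f := icoef (phi f * jacobian (fun i => phi (tvar A i))) (const_mx (-1)) -
  locZ_to (dphi phi) * icoef f (const_mx (-1)).
suff T0 : T f = 0 by apply/eqP; rewrite -subr_eq0 -/(T f) T0.
move: f; apply: monomial_functional_ext => [f g||c l]; rewrite /T.
- by rewrite rmorphB mulrBl !icoefB mulrBr opprD addrACA -!opprD.
- apply: vanishes_near0D.
    exact: (vanishes_near0_phi (vanishes_near0_icoefM _ _)).
  apply: (vanishes_near0_comp (h := fun x => - (locZ_to (dphi phi) * x))).
    by rewrite mulr0 oppr0.
  exact: vanishes_near0_icoef.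
rewrite phi_monomial jacobian_phi icoef_mono.
have -> : constL n c * G l * (G (const_mx 1) * monomial 1 (const_mx (-1)) * \det (rows_mx (dlog_row G)))
  = constL n c * (monomial 1 (const_mx (-1)) * (G (l + const_mx 1) * \det (rows_mx (dlog_row G)))).
  by rewrite GD; ring.
rewrite icoef_constM icoef_monoM subrr mul1r residue_phi.
have -> : (const_mx (-1) == l) = (l + const_mx 1 == 0).
  rewrite addr_eq0 eq_sym; congr (_ == _); apply/colP => j; by rewrite !mxE.
by case: ifP => _; rewrite ?mulr0 ?subrr // mulrC subrr.
Qed.

End ContinuousHomomorphism.

Theorem corollary5p4 (A : comPzRingType) (n : nat) (n_ge1 : (1 <= n)%N)
    (phi : {rmorphism iter_laurent A n -> iter_laurent A n})
    (phi_alg : forall a : A, phi (constL n a) = constL n a)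
    (phi_cont : continuous phi) (omega : omegan A n) :
  res (form_map phi omega) = locZ_to (dphi phi) * res omega.
Proof. by rewrite res_form_map residue_pullback. Qed.
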